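(* Let $n\ge 1$ and $K_1,K_2>0$. For $j=1,\ldots,n$ let $(Z_{1j},Z_{2j})$ be independent (across $j$) pairs of possibly correlated real random variables with $\mathbb{E}Z_{1j}=\mathbb{E}Z_{2j}=0$ and $\|Z_{ij}\|_{\psi_2}\le K_i$ for $i=1,2$ and all $j$. Let $(\gamma_{1j},\gamma_{2j})$, $j=1,\ldots,n$, be independent (across $j$) pairs of possibly correlated Bernoulli random variables with $\mathbb{E}\gamma_{ij}=\pi_{ij}$ ($i=1,2$) and $\mathbb{E}\gamma_{1j}\gamma_{2j}=\pi_{12,j}$. Assume the family $\{Z_{ij}\}$ is independent of the family $\{\gamma_{ij}\}$. Let $\boldsymbol{A}=(a_{ij})$ be a deterministic real $n\times n$ matrix. Then there is a numerical constant $c>0$ such that for every $t>0$, $$ \mathrm{P}\Big[\big|(\boldsymbol{Z}_1*\boldsymbol{\gamma}_1)^\top\boldsymbol{A}(\boldsymbol{Z}_2*\boldsymbol{\gamma}_2)-\mathbb{E}(\boldsymbol{Z}_1*\boldsymbol{\gamma}_1)^\top\boldsymbol{A}(\boldsymbol{Z}_2*\boldsymbol{\gamma}_2)\big|>t\Big]\le 2\exp\Big\{-c\min\Big(\frac{t^2}{K_1^2K_2^2\|\boldsymbol{A}\|_{F,\pi}^2},\frac{t}{K_1K_2\|\boldsymbol{A}\|_2}\Big)\Big\}, $$ where $\|\boldsymbol{A}\|_{F,\pi}=\sqrt{\sum_{j=1}^n\pi_{12,j}a_{jj}^2+\sum_{i\ne j}a_{ij}^2\pi_{1i}\pi_{2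j}}$.
   Context: For a real random variable $X$, $\|X\|_{\psi_2}=\sup_{p\ge1}(\mathbb{E}|X|^p)^{1/p}/\sqrt{p}$. $\boldsymbol{Z}_i=(Z_{i1},\ldots,Z_{in})^\top$, $\boldsymbol{\gamma}_i=(\gamma_{i1},\ldots,\gamma_{in})^\top$, and $*$ denotes the Hadamard (entrywise) product. $\|\boldsymbol{A}\|_2$ is the operator norm (square root of the largest eigenvalue of $\boldsymbol{A}^\top\boldsymbol{A}$). *)

(* Defs.v *)
From HB Require Import structures.
From mathcomp Require Import all_boot all_order all_algebra.
From mathcomp Require Import all_classical all_reals all_analysis.
Set Implicit Arguments. Unset Strict Implicit. Unset Printing Implicit Defensive.
Import Order.TTheory GRing.Theory Num.Theory.
Local Open Scope classical_set_scope.
Local Open Scope ring_scope.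

Section defs.
Context {R : realType} {d : measure_display} {T : measurableType d}.
Variable P : probability T R.

Definition sigma_of (I : Type) (X : I -> T -> R) : set (set T) :=
  <<s [set A | exists i (B : set R), measurable B /\ A = X i @^-1` B] >>.

Definition indep_sigma (I : eqType) (F : I -> set (set T)) : Prop :=
  forall (J : seq I) (E : I -> set T), uniq J ->
    (forall i, i \in J -> F i (E i)) ->
    fine (P (\big[setI/setT]_(i <- J) E i)) = \prod_(i <- J) fine (P (E i)).

Definition psi2norm (X : T -> R) : \bar R :=
  ereal_sup [set (poweR ('E_P[fun w => (`|X w| `^ p)%R]) p^-1 * ((Num.sqrt p)^-1)%:E)%E
            | p in [set p : R | 1 <= p]].
End defs.

Definition opnorm2 {R : realType} (n : nat) (A : 'M[R]_n) : R :=
  Num.sqrt (sup [set a : R | eigenvalue (A^T *m A) a]).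

Definition normFpi {R : realType} (n : nat) (A : 'M[R]_n)
  (pi1 pi2 pi12 : 'I_n -> R) : R :=
  Num.sqrt (\sum_(j < n) pi12 j * A j j ^+ 2
            + \sum_(i < n) \sum_(j < n | i != j) A i j ^+ 2 * pi1 i * pi2 j).

(* Main.v *)
(* Hanson-Wright without Gaussian comparison. Conditionally on the Bernoulli
   variables the form is a bilinear form in Z with matrix D1 A D2. Its diagonal
   is a sum of independent centered sub-exponential variables. Its off-diagonal
   part is decoupled: averaging over random subsets L of the indices, it suffices
   to bound the form restricted to L x L^c, and integrating out the second factor
   leaves the moment generating function of some |B^T X|^2 with |B| small.
   Expanding |B^T X|^2 and decoupling once more reproduces an expression of the
   same kind with weight 1/2, so iterating an arbitrary a priori bound yields
   E exp |B^T X|^2 <= exp (C |B|_F^2). What remains is the exponential moment of a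
   bilinear form in the Bernoulli variables with small coefficients, handled by
   the same decoupling together with E exp (y g) <= exp (p (y + 2 y^2)); this
   is where the weights pi in |A|_{F,pi} come from. The bound
   E exp (x (Q - q)) <= exp (C x^2) for all small x of both signs forces q = E Q,
   and Chernoff's inequality concludes. *)
Require Import Defs.
From HB Require Import structures.
From mathcomp Require Import all_boot all_order all_algebra.
From mathcomp Require Import all_classical all_reals all_analysis.
From mathcomp Require Import measurable_realfun.
From mathcomp Require Import ring lra.
Set Implicit Arguments.
Unset Strict Implicit.
Unset Printing Implicit Defensive.
Import Order.TTheory GRing.Theory Num.Theory.
Import numFieldNormedType.Exports.
Local Open Scope classical_set_scope.
Local Open Scope ring_scope.

(** The two variables carrying the same index may be correlated. On L x L^c they never meet, so
    independence across indices suffices there and the variables can be integrated out one at a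
    time; no independent copy is introduced. The diagonal and off-diagonal parts are dependent on
    each other. They are glued by e^(f+g) <= (e^(2f) + e^(2g)) / 2 after normalization, which is why
    so many exponents carry a factor 2. The Bernoulli terms need two levels of precision. After
    conditioning, the diagonal exponent contains a term linear in a_jj, of either sign, which must
    cancel exactly against the centering; hence a Bernoulli bound whose leading term p y has
    coefficient 1. Off the diagonal the exponent is nonnegative and already quadratic in a_ij, so
    the loss p (y + 2 y^2) <= 2 p y is harmless. Exponential moments live in the extended reals, so
    a bound can be proved before any integrability is known. *)

Section scalar_inequalities.
Context {R : realType}.
Implicit Types x y z : R.

(** Compare after multiplying by [1 - x]: on the left [1 - x <= expR (- x)] gives at most 1, on the
    right the product is [1 + x ^+ 2 * (1 - 2 * x)], at least 1. Negative [x] of any size is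
    allowed. *)
Lemma expR_le_1D2sqr x : x <= 2^-1 -> expR x <= 1 + x + 2 * x ^+ 2.
Proof.
move=> x2; have /= h := expR_ge1Dx (- x).
have x1 : 0 < 1 - x by lra.
have e0 := expR_gt0 x.
have : expR x * (1 - x) <= 1.
  by rewrite -[leRHS](expRxMexpNx_1 x) ler_pM2l.
move=> h1; rewrite -(ler_pM2r x1); apply: le_trans h1 _.
have : 0 <= x ^+ 2 * (1 - 2 * x) by rewrite mulr_ge0 ?sqr_ge0//; lra.
nra.
Qed.

(** For a centered variable the linear term integrates to zero, so exponential moments of the square
    control the Laplace transform. *)
Lemma expR_le_add_expR_sqr x : expR x <= x + expR (2 * x ^+ 2).
Proof.
have [x2|x2] := leP x 2^-1.
  apply: (le_trans (expR_le_1D2sqr x2)).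
  have := expR_ge1Dx (2 * x ^+ 2); lra.
have : expR x <= expR (2 * x ^+ 2) by rewrite ler_expR; nra.
lra.
Qed.

Lemma expR_le_taylor2 x : expR x <= 1 + x + 4 * x ^+ 2 * expR `|x|.
Proof.
have e1 : 1 <= expR `|x| by rewrite -expR0 ler_expR.
have [x2|x2] := leP x 2^-1.
  apply: (le_trans (expR_le_1D2sqr x2)).
  have : 0 <= x ^+ 2 by rewrite sqr_ge0.
  nra.
have e2 : expR x <= expR `|x| by rewrite ler_expR ler_norm.
have : 1 <= 4 * x ^+ 2 by nra.
nra.
Qed.

Lemma sqr_le_2expR x : 0 <= x -> x ^+ 2 <= 2 * expR x.
Proof.
move=> x0; have := expR_ge1Dxn 1 x0.
rewrite (_ : 2`! = 2)%N// => h; lra.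
Qed.

Lemma expR_avg2 x y : expR (x + y) <= 2^-1 * (expR (2 * x) + expR (2 * y)).
Proof.
have -> : 2 * x = x + x by ring.
have -> : 2 * y = y + y by ring.
rewrite !expRD.
have := sqr_ge0 (expR x - expR y); nra.
Qed.

End scalar_inequalities.

(** * Decoupling *)

Section decoupling.
Context {R : realType}.

(** Jensen's inequality for a uniform average, from the tangent line of [expR] at the mean [m]: the
    linear corrections sum to zero. *)
Lemma expR_mean (I : finType) (f : I -> R) : (0 < #|I|)%N ->
  expR (#|I|%:R^-1 * \sum_i f i) <= #|I|%:R^-1 * \sum_i expR (f i).
Proof.
move=> I0; set m := _^-1 * _.
have N0 : (0 : R) < #|I|%:R by rewrite ltr0n.
rewrite -ler_pdivrMl ?invr_gt0// invrK.
have : \sum_i (expR m * (1 + (f i - m))) <= \sum_i expR (f i).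
  apply: ler_sum => i _.
  have -> : expR (f i) = expR m * expR (f i - m) by rewrite -expRD; congr expR; ring.
  by rewrite ler_pM2l ?expR_gt0// expR_ge1Dx.
rewrite -mulr_sumr big_split/= sumrB !sumr_const.
have -> : m *+ #|I| = \sum_i f i.
  by rewrite -mulr_natl /m mulrA divff ?mul1r// gt_eqF.
by rewrite subrr addr0 mulrC.
Qed.

(** Adding [i] is a bijection from the subsets of the complement of {i, j} onto these sets. A
    uniform random subset thus separates an ordered pair with probability 1/4, the source of the
    factor 4 in decoupling. *)
Lemma card_set_separating n (i j : 'I_n) : i != j ->
  (4 * #|[set L : {set 'I_n} | (i \in L) && (j \notin L)]%SET| = 2 ^ n)%N.
Proof.
move=> ij.
have -> : [set L : {set 'I_n} | (i \in L) && (j \notin L)]%SET =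
    [set (i |: L) | L in powerset (~: [set i; j])]%SET.
  apply/finset.setP => L; rewrite !inE; apply/andP/imsetP => [[iL jL]|[M]].
    exists (L :\ i)%SET; last by rewrite finset.setD1K.
    rewrite powersetE; apply/fintype.subsetP => k; rewrite !inE negb_or => /andP[-> kL] /=.
    by apply: contraNneq jL => <-.
  rewrite powersetE => /fintype.subsetP sM ->; rewrite !inE eqxx eq_sym (negbTE ij)/=; split => //.
  by apply/negP => /sM; rewrite !inE eqxx orbT.
rewrite card_in_imset; last first.
  move=> M M'; rewrite !powersetE => /fintype.subsetP sM /fintype.subsetP sM' e.
  have nM (B : {set 'I_n}) : {subset B <= (~: [set i; j])%SET} -> i \notin B.
    by move=> h; apply/negP => /h; rewrite !inE eqxx.
  by rewrite -(finset.setU1K (nM _ sM)) e finset.setU1K// nM.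
rewrite card_powerset -[4%N]/(2 ^ 2)%N -expnD.
have := cardsC [set i; j]%SET; rewrite cards2 ij card_ord.
by move=> ->.
Qed.

Lemma sum_separating n (c : 'I_n -> 'I_n -> R) :
  \sum_(i < n) \sum_(j < n | i != j) c i j =
  #|{set 'I_n}|%:R^-1 *
    \sum_(L : {set 'I_n}) (4 * \sum_(i in L) \sum_(j | j \notin L) c i j).
Proof.
have c0 : (#|{set 'I_n}|%:R : R) != 0.
  by rewrite pnatr_eq0 -lt0n; apply/card_gt0P; exists finset.set0.
apply: (mulfI c0); rewrite mulrA divff// mul1r -mulr_sumr.
under [in RHS]eq_bigr => L _.
  rewrite (big_mkcond (mem L))/=.
  under eq_bigr => i _.
    rewrite big_mkcond/=.
    rewrite (_ : (if _ then _ else _) =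
      \sum_j if (i \in L) && (j \notin L) then c i j else 0); last first.
      by case: (i \in L) => //=; rewrite big1.
    over.
  over.
rewrite exchange_big/= !mulr_sumr; apply: eq_bigr => i _.
rewrite exchange_big/= !mulr_sumr big_mkcond; apply: eq_bigr => j _.
rewrite -big_mkcond/= sumr_const.
have -> : #|[pred L : {set 'I_n} | (i \in L) && (j \notin L)]| =
    #|[set L : {set 'I_n} | (i \in L) && (j \notin L)]%SET|.
  by apply: eq_card => L; rewrite !inE.
case: ifPn => [ij|].
  rewrite mulrnAr -mulrnAl -mulrnA card_set_separating//.
  by rewrite -cardsT -powersetT card_powerset cardsT card_ord.
rewrite negbK => /eqP ->.
rewrite (_ : [set L | _]%SET = finset.set0) ?cards0 ?mulr0n ?mulr0//.
by apply/finset.setP => L; rewrite !inE andbN.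
Qed.

Lemma expR_decoupling n (c : 'I_n -> 'I_n -> R) :
  expR (\sum_(i < n) \sum_(j < n | i != j) c i j) <=
  #|{set 'I_n}|%:R^-1 *
    \sum_(L : {set 'I_n}) expR (4 * \sum_(i in L) \sum_(j | j \notin L) c i j).
Proof.
rewrite sum_separating; apply: expR_mean.
by apply/card_gt0P; exists finset.set0.
Qed.

End decoupling.

(** * Independence and conditioning *)

Section independent_fubini.
Context {d} {T : measurableType d} {R : realType} (P : probability T R).
Variables G H : set (set T).
Hypotheses (Gm : G `<=` measurable) (Hm : H `<=` measurable).

Lemma measurable_id_g_sigma (K : set (set T)) : K `<=` measurable ->
  measurable_fun setT (id : T -> g_sigma_algebraType K).
Proof.
move=> Km _ B mB; rewrite setTI preimage_id.
exact: (smallest_sub (@sigma_algebra_measurable _ T) Km).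
Qed.

(** [phi1] is the identity seen as a map into a coarser measurable space. Under its law the inner
    integral becomes a Tonelli section, measurable for the sigma-algebra of [H] and hence for the
    full one. *)
Lemma measurable_fubini_indep
    (F : g_sigma_algebraType G * g_sigma_algebraType H -> \bar R) :
  measurable_fun [set: (g_sigma_algebraType G * g_sigma_algebraType H)%type] F ->
  (forall x, 0 <= F x)%E ->
  measurable_fun setT (fun w : T => \int[P]_v F (v, w))%E.
Proof.
move=> mF F0.
pose phi1 : {mfun T >-> g_sigma_algebraType G} :=
  HB.pack (id : T -> g_sigma_algebraType G)
    (isMeasurableFun.Build _ _ _ _ _ (measurable_id_g_sigma Gm)).
have mG := @measurable_fun_fubini_tonelli_G _ _ _ _ _ (distribution P phi1) F mF F0.
rewrite [X in measurable_fun _ X](_ : _ =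
    fubini_G (distribution P phi1) F \o (id : T -> g_sigma_algebraType H)).
  exact: measurableT_comp (measurable_id_g_sigma Hm).
apply/funext => w /=; rewrite /fubini_G (ge0_integral_distribution phi1)//.
exact: measurableT_comp.
Qed.

Hypothesis GH : forall A B, <<s G >> A -> <<s H >> B ->
  P (A `&` B) = (P A * P B)%E.

(* The diagonal map w |-> (w, w) pushes P forward to the product of the
   restrictions of P to the two sigma-algebras. *)
Lemma fubini_indep 
    (F : g_sigma_algebraType G * g_sigma_algebraType H -> \bar R) :
  measurable_fun [set: (g_sigma_algebraType G * g_sigma_algebraType H)%type] F ->
  (forall x, 0 <= F x)%E ->
  (\int[P]_w F (w, w) = \int[P]_w \int[P]_v F (v, w))%E.
Proof.
move=> mF F0.
pose phi1 : {mfun T >-> g_sigma_algebraType G} :=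
  HB.pack (id : T -> g_sigma_algebraType G)
    (isMeasurableFun.Build _ _ _ _ _ (measurable_id_g_sigma Gm)).
pose phi2 : {mfun T >-> g_sigma_algebraType H} :=
  HB.pack (id : T -> g_sigma_algebraType H)
    (isMeasurableFun.Build _ _ _ _ _ (measurable_id_g_sigma Hm)).
have mdiag : measurable_fun setT (fun w : T => (phi1 w, phi2 w)).
  by apply: measurable_fun_pair; exact: measurable_funPT.
pose diag : {mfun T >-> (g_sigma_algebraType G * g_sigma_algebraType H)%type} :=
  HB.pack (fun w : T => (phi1 w, phi2 w)) (isMeasurableFun.Build _ _ _ _ _ mdiag).
transitivity (\int[distribution P diag]_x F x)%E.
  by rewrite (ge0_integral_distribution diag).
transitivity (\int[distribution P phi1 \x distribution P phi2]_x F x)%E.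
  (* On a rectangle A x B the law of [diag] is the probability of the intersection, which [GH]
     factors; rectangles determine the product measure. *)
  apply: eq_measure_integral => A mA _; apply/esym/product_measure_unique => //.
rewrite fubini_tonelli2//.
rewrite (ge0_integral_distribution phi2); last 2 first.
- exact: measurable_fun_fubini_tonelli_G.
- by move=> y; apply: integral_ge0.
apply: eq_integral => w _ /=; rewrite /fubini_G (ge0_integral_distribution phi1)//.
exact: measurableT_comp.
Qed.

End independent_fubini.

Section independent_families.
Context {d} {T : measurableType d} {R : realType} (P : probability T R).

Lemma indep_sigma2 (G H : set (set T)) :
  (forall b : bool, (if b then G else H) `<=` measurable) ->
  indep_sigma P (fun b : bool => if b then G else H) ->
  forall A B, G A -> H B -> P (A `&` B) = (P A * P B)%E.
Proof.
move=> GHm ind A B GA HB.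
have mA := GHm true _ GA; have mB := GHm false _ HB.
have GHAB (b : bool) : (if b then G else H) (if b then A else B) by case: b.
have := ind [:: true; false] _ isT (fun b _ => GHAB b).
rewrite !big_cons !big_nil setIT mulr1 => e.
rewrite -(fineK (fin_num_measure P _ (measurableI _ _ mA mB))) e EFinM.
by rewrite !fineK// fin_num_measure.
Qed.

Context {I : finType} (gen : I -> set (set T)).

Definition gens (S : pred I) : set (set T) :=
  [set A | exists2 i, S i & gen i A].

Lemma sub_gens (S S' : pred I) : {subset S <= S'} -> gens S `<=` gens S'.
Proof. by move=> SS' A [i Si giA]; exists i => //; exact: SS'. Qed.

Lemma gen_sub_gens (S : pred I) i : S i -> gen i `<=` gens S.
Proof. by move=> Si A giA; exists i. Qed.

Hypothesis genm : forall i, gen i `<=` measurable.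

Lemma gens_measurable S : gens S `<=` measurable.
Proof. by move=> A [i _ /genm]. Qed.

Hypothesis ind : indep_sigma P (fun i => <<s gen i >>).

(** Uniqueness of finite measures on a pi-system: C -> P(C and A) and C -> P(A) P(C) agree on the
    class [Q] of intersections of one event per block other than [j], and [Q] generates the
    sigma-algebra of those blocks. *)
Lemma indep_gens j A B : <<s gen j >> A -> <<s gens (predC1 j) >> B ->
  P (A `&` B) = (P A * P B)%E.
Proof.
move=> sA sB.
have sm i C : <<s gen i >> C -> measurable C.
  exact: (smallest_sub (@sigma_algebra_measurable _ T) (@genm i)).
have mA := sm _ _ sA.
pose J := [seq i <- enum I | i != j].
have uJ : uniq J by rewrite filter_uniq// enum_uniq.
pose Q := [set B | exists2 E : I -> set T, (forall i, <<s gen i >> (E i)) &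
                   B = \big[setI/setT]_(i <- J) E i].
have Qm : Q `<=` measurable.
  by move=> _ [E sE ->]; apply: bigsetI_measurable => i _; exact: sm (sE i).
have gT i : <<s gen i >> setT.
  exact: (@measurableT _ (g_sigma_algebraType (gen i))).
have QI : setI_closed Q.
  move=> _ _ [E sE ->] [F sF ->]; exists (fun i => E i `&` F i).
    move=> i.
    exact: (@measurableI _ (g_sigma_algebraType (gen i)) _ _ (sE i) (sF i)).
  by rewrite big_split.
have QT : Q setT by exists (fun=> setT) => //; rewrite big1.
have PA0 : 0 <= fine (P A) by rewrite fine_ge0.
pose m1 := mrestr P mA; pose m2 := mscale (NngNum PA0) P.
have m12 C : Q C -> m1 C = m2 C.
  move=> QC; have mC := Qm _ QC; case: QC => E sE CE.
  rewrite /m1 /m2 /mrestr /mscale/=.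
  have jJ : j \notin J by rewrite mem_filter eqxx.
  (* With [A] in place [j], independence over [j :: J] can be compared with independence over
     [J]. *)
  pose E' i := if i == j then A else E i.
  have EE' : \big[setI/setT]_(i <- J) E i = \big[setI/setT]_(i <- J) E' i.
    by apply: eq_big_seq => i iJ; rewrite /E'; case: eqVneq iJ jJ => // -> ->.
  have PEE' : \prod_(i <- J) fine (P (E i)) = \prod_(i <- J) fine (P (E' i)).
    by apply: eq_big_seq => i iJ; rewrite /E'; case: eqVneq iJ jJ => // -> ->.
  have sE' i : <<s gen i >> (E' i) by rewrite /E'; case: eqP => // ->.
  have hC := ind uJ (fun i _ => sE i).
  have ujJ : uniq (j :: J) by rewrite /= jJ.
  have := ind ujJ (fun i _ => sE' i).
  have E'j : E' j = A by rewrite /E' eqxx.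
  rewrite !big_cons E'j -EE' -PEE' -hC -CE => h.
  rewrite setIC -(fineK (fin_num_measure P _ (measurableI _ _ mA mC))) h EFinM.
  by rewrite (fineK (fin_num_measure P _ mC)).
have sQB : <<s Q >> B.
  move: B sB; apply: smallest_sub; first exact: smallest_sigma_algebra.
  move=> C [i /= ij giC]; apply: sub_sigma_algebra.
  exists (fun k => if k == i then C else setT).
    by move=> k; case: eqVneq => [->|//]; exact: sub_sigma_algebra.
  have iJ : i \in J by rewrite mem_filter ij mem_enum.
  rewrite (bigD1_seq i)//= eqxx big1 ?setIT//.
  by move=> k /negbTE ->.
have cov : \bigcup_(_ in [set: nat]) [set: T] = setT.
  by apply/seteqP; split => // x _; exists 0%N.
have m1T (_ : nat) : (m1 setT < +oo)%E.
  rewrite /m1 /mrestr/= setTI; apply: le_lt_trans (ltry 1).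
  exact: probability_le1.
have e : P (B `&` A) = ((fine (P A))%:E * P B)%E :=
  @g_sigma_algebra_measure_unique _ R T Q Qm (fun=> setT) (fun=> QT) cov
    m1 m2 QI m12 m1T _ sQB.
by rewrite setIC e fineK// fin_num_measure.
Qed.

End independent_families.

Lemma measurable_sum_cond d (T : measurableType d) (R : realType) (I : Type)
    (s : seq I) (p : pred I) (h : I -> T -> R) :
  (forall i, p i -> measurable_fun setT (h i)) ->
  measurable_fun setT (fun w => \sum_(i <- s | p i) h i w).
Proof.
move=> mh; elim: s => [|i s IHs].
  rewrite (_ : (fun _ => _) = cst 0); first exact: measurable_cst.
  by apply/funext => w; rewrite big_nil.
rewrite (_ : (fun _ => _) = (fun w => (if p i then h i w else 0) +
    \sum_(j <- s | p j) h j w)); last first.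
  by apply/funext => w; rewrite big_cons; case: ifP; rewrite ?add0r.
by apply: measurable_funD => //; have [/mh|] := boolP (p i).
Qed.

(** * Exponential moments: gluing, decoupling, integrating out variables *)

Section exponential_moment.
Context {d} {T : measurableType d} {R : realType} (P : probability T R).
Implicit Types (f g : T -> R) (G H : set (set T)).

Definition Eexp f : \bar R := (\int[P]_w (expR (f w))%:E)%E.

Definition adapted G f :=
  measurable_fun [set: g_sigma_algebraType G] (f : g_sigma_algebraType G -> R).

Lemma adapted_sub G H f : G `<=` H -> adapted G f -> adapted H f.
Proof.
move=> GH af mT B mB.
apply: (sub_smallest2r _ GH); first exact: smallest_sigma_algebra.
exact: af.
Qed.

Lemma adapted_measurable G f : G `<=` measurable -> adapted G f ->
  measurable_fun setT f.
Proof.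
move=> Gm af mT B mB.
apply: (smallest_sub (@sigma_algebra_measurable _ T) Gm).
exact: af.
Qed.

Lemma measurable_EexpR f : measurable_fun setT f ->
  measurable_fun setT (fun w => (expR (f w))%:E).
Proof. by move=> mf; apply/measurable_EFinP; exact: measurableT_comp. Qed.

Lemma Eexp_ge0 f : (0 <= Eexp f)%E.
Proof. by apply: integral_ge0 => w _; rewrite lee_fin expR_ge0. Qed.

Lemma Eexp_cst r : Eexp (fun=> r) = (expR r)%:E.
Proof.
have := integral_cst P measurableT (expR r)%:E.
by rewrite /= probability_setT mule1.
Qed.

Lemma le_Eexp f g : measurable_fun setT f -> measurable_fun setT g ->
  (forall w, f w <= g w) -> (Eexp f <= Eexp g)%E.
Proof.
move=> mf mg fg; apply: ge0_le_integral => //.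
- exact: measurable_EexpR.
- exact: measurable_EexpR.
- by move=> w _; rewrite lee_fin ler_expR.
Qed.

Lemma EexpD_cst f r : measurable_fun setT f ->
  Eexp (fun w => f w + r) = ((expR r)%:E * Eexp f)%E.
Proof.
move=> mf; rewrite /Eexp -ge0_integralZl//; last exact: measurable_EexpR.
by apply: eq_integral => w _; rewrite expRD EFinM muleC.
Qed.

Lemma EexpD_cst_le f r s : measurable_fun setT f ->
  (Eexp f <= (expR s)%:E)%E -> (Eexp (fun w => (f w + r)%R) <= (expR (s + r))%:E)%E.
Proof.
move=> mf fs; rewrite EexpD_cst// expRD mulrC EFinM.
by rewrite lee_wpmul2l// lee_fin expR_ge0.
Qed.

(** Takes the place of Cauchy-Schwarz for dependent [f] and [g]: once [a] and [b] are subtracted,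
    both doubled moments are at most 1, and so is their mean, which dominates by [expR_avg2]. *)
Lemma EexpD_le f g a b : measurable_fun setT f -> measurable_fun setT g ->
  (Eexp (fun w => (2 * f w)%R) <= (expR (2 * a))%:E)%E ->
  (Eexp (fun w => (2 * g w)%R) <= (expR (2 * b))%:E)%E ->
  (Eexp (fun w => (f w + g w)%R) <= (expR (a + b))%:E)%E.
Proof.
move=> mf mg fa gb.
have mf2 : measurable_fun setT (fun w => 2 * f w) by apply: measurable_funM.
have mg2 : measurable_fun setT (fun w => 2 * g w) by apply: measurable_funM.
have mfa : measurable_fun setT (fun w => 2 * f w + - (2 * a)) by apply: measurable_funD.
have mgb : measurable_fun setT (fun w => 2 * g w + - (2 * b)) by apply: measurable_funD.
have {}fa : (Eexp (fun w => (2 * f w + - (2 * a))%R) <= 1)%E.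
  by apply: le_trans (EexpD_cst_le _ mf2 fa) _; rewrite subrr expR0.
have {}gb : (Eexp (fun w => (2 * g w + - (2 * b))%R) <= 1)%E.
  by apply: le_trans (EexpD_cst_le _ mg2 gb) _; rewrite subrr expR0.
have -> : (fun w => f w + g w) = (fun w => (f w - a) + (g w - b) + (a + b)).
  by apply/funext => w; ring.
have mD : measurable_fun setT (fun w => (f w - a) + (g w - b)).
  by do 2!apply: measurable_funD => //.
rewrite -[in leRHS](add0r (a + b)); apply: EexpD_cst_le => //; rewrite expR0.
have : (Eexp (fun w => (f w - a) + (g w - b))%R <=
   \int[P]_w ((2^-1)%:E * ((expR (2 * f w + - (2 * a)))%:E +
                           (expR (2 * g w + - (2 * b)))%:E)))%E.
  apply: ge0_le_integral => //.
  - exact: measurable_EexpR.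
  - by apply: measurable_funeM; apply: emeasurable_funD; exact: measurable_EexpR.
  - move=> w _; rewrite -EFinD -EFinM lee_fin.
    have := expR_avg2 (f w - a) (g w - b); rewrite !mulrBr; lra.
move=> /le_trans; apply.
rewrite ge0_integralZl//; last 2 first.
- by apply: emeasurable_funD; exact: measurable_EexpR.
- by move=> w _; rewrite adde_ge0// lee_fin expR_ge0.
rewrite ge0_integralD//; [|exact: measurable_EexpR|exact: measurable_EexpR].
rewrite (_ : 1 = (2^-1)%:E * (1 + 1))%E; last first.
  by rewrite -EFinD -EFinM; congr EFin; lra.
by rewrite lee_wpmul2l ?lee_fin ?invr_ge0// leeD.
Qed.

Lemma Eexp_decoupling n (c : 'I_n -> 'I_n -> T -> R) (M : R) :
  (forall i j, measurable_fun setT (c i j)) ->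
  (forall L : {set 'I_n},
    Eexp (fun w => 4 * \sum_(i in L) \sum_(j | j \notin L) c i j w)%R <= M%:E)%E ->
  (Eexp (fun w => \sum_(i < n) \sum_(j < n | i != j) c i j w)%R <= M%:E)%E.
Proof.
move=> mc hM.
have mL (L : {set 'I_n}) : measurable_fun setT
    (fun w => 4 * \sum_(i in L) \sum_(j | j \notin L) c i j w).
  apply: measurable_funM => //.
  by do 2!(apply: measurable_sum_cond => ? _).
set N := #|{set 'I_n}|.
have N0 : (0 : R) < N%:R.
  by rewrite ltr0n; apply/card_gt0P; exists finset.set0.
have : (Eexp (fun w => \sum_(i < n) \sum_(j < n | i != j) c i j w)%R <=
   \int[P]_w ((N%:R^-1)%:E * \sum_(L : {set 'I_n})
     (expR (4 * \sum_(i in L) \sum_(j | j \notin L) c i j w))%:E))%E.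
  apply: ge0_le_integral => //.
  - by apply: measurable_EexpR; do 2!(apply: measurable_sum_cond => ? _).
  - apply: measurable_funeM; apply: emeasurable_sum => L.
    exact: measurable_EexpR.
  - by move=> w _; rewrite sumEFin -EFinM lee_fin; exact: expR_decoupling.
move=> /le_trans; apply.
rewrite ge0_integralZl//; [|by apply: emeasurable_sum => L; exact: measurable_EexpR
  |by move=> w _; apply: sume_ge0 => L _; rewrite lee_fin expR_ge0].
rewrite ge0_integral_sum//; [|by move=> L; exact: measurable_EexpR].
apply: (@le_trans _ _ ((N%:R^-1)%:E * \sum_(L : {set 'I_n}) M%:E)%E).
  rewrite lee_wpmul2l ?lee_fin ?invr_ge0 ?(ltW N0)//.
  by apply: lee_sum => L _; exact: hM.
by rewrite sumEFin sumr_const -/N -[M *+ _]mulr_natl -EFinM mulrA mulVf ?gt_eqF// mul1r lexx.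
Qed.

Lemma Eexp_conditional G H (Y u f : T -> R) (rho : R -> R) (D : set R) :
  G `<=` measurable -> H `<=` measurable ->
  (forall A B, <<s G >> A -> <<s H >> B -> P (A `&` B) = P A * P B)%E ->
  adapted G Y -> adapted H u -> adapted H f -> measurable_fun setT rho ->
  (forall w, D (u w)) ->
  (forall s, D s -> (Eexp (fun w => Y w * s)%R <= (expR (rho s))%:E)%E) ->
  (Eexp (fun w => Y w * u w + f w)%R <= Eexp (fun w => rho (u w) + f w)%R)%E.
Proof.
move=> Gm Hm GH aY au af mrho Du Yrho.
have mY := adapted_measurable Gm aY; have mu := adapted_measurable Hm au.
have mf := adapted_measurable Hm af.
pose F (x : g_sigma_algebraType G * g_sigma_algebraType H) :=
  (expR (Y x.1 * u x.2 + f x.2))%:E.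
have mF : measurable_fun [set: (g_sigma_algebraType G * g_sigma_algebraType H)%type] F.
  apply/measurable_EFinP; apply: measurableT_comp => //.
  apply: measurable_funD; last exact: (measurableT_comp af).
  by apply: measurable_funM; [exact: (measurableT_comp aY)|exact: (measurableT_comp au)].
have F0 x : (0 <= F x)%E by rewrite lee_fin expR_ge0.
rewrite {1}/Eexp (fubini_indep Gm Hm GH mF F0).
have mG : measurable_fun setT (fun w : T => \int[P]_v F (v, w))%E.
  exact: (measurable_fubini_indep P Gm Hm mF F0).
apply: ge0_le_integral => //.
- by move=> w _; exact: integral_ge0.
- by apply: measurable_EexpR; apply: measurable_funD => //; exact: measurableT_comp.
- move=> w _; rewrite /F/=.
  have mYu : measurable_fun setT (fun v => Y v * u w) by exact: measurable_funM.
  have := EexpD_cst_le (f w) mYu (Yrho _ (Du w)); exact.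
Qed.

Section chain.
Context {I : finType} (gen : I -> set (set T)).
Hypothesis genm : forall i, gen i `<=` measurable.
Hypothesis ind : indep_sigma P (fun i => <<s gen i >>).

(* The variables Y j, j in s, are integrated out one at a time, conditionally
   on all the others. *)
Lemma Eexp_chain (s : seq I) (S : pred I) (Y u : I -> T -> R) f
    (rho : I -> R -> R) (D : set R) :
  uniq s -> (forall j, j \in s -> ~~ S j) ->
  (forall j, adapted (gen j) (Y j)) ->
  (forall j, adapted (gens gen S) (u j)) -> adapted (gens gen S) f ->
  (forall j, measurable_fun setT (rho j)) ->
  (forall j w, D (u j w)) ->
  (forall j r, D r -> (Eexp (fun w => Y j w * r)%R <= (expR (rho j r))%:E)%E) ->
  (Eexp (fun w => \sum_(j <- s) Y j w * u j w + f w)%R <=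
   Eexp (fun w => \sum_(j <- s) rho j (u j w) + f w)%R)%E.
Proof.
move=> + + aY au + mrho Du Yrho.
elim: s f => [|j s IHs] f /=.
  by move=> _ _ af; rewrite le_eqVlt; apply/orP; left; apply/eqP; congr Eexp;
    apply/funext => w; rewrite !big_nil.
move=> /andP[js us] sS af.
have subS : {subset S <= predC1 j}.
  move=> i Si; rewrite inE; apply: contraTneq Si => ->.
  by apply: sS; rewrite mem_head.
have sub := sub_gens subS.
have aY' i : i != j -> adapted (gens gen (predC1 j)) (Y i).
  by move=> ij; apply: adapted_sub (aY i); exact: gen_sub_gens.
(* The price [rho j (u j w)] of removing [Y j] depends only on blocks in [S], so it can be absorbed
   into [f]; hence the induction over arbitrary [f]. *)
apply: (@le_trans _ _
    (Eexp (fun w => \sum_(i <- s) Y i w * u i w + (rho j (u j w) + f w)))).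
  rewrite [X in (X <= _)%E](_ : _ = Eexp (fun w => Y j w * u j w +
      (\sum_(i <- s) Y i w * u i w + f w))); last first.
    by congr Eexp; apply/funext => w; rewrite big_cons addrA.
  rewrite [X in (_ <= X)%E](_ : _ = Eexp (fun w => rho j (u j w) +
      (\sum_(i <- s) Y i w * u i w + f w))); last first.
    by congr Eexp; apply/funext => w; rewrite addrCA.
  apply: (@Eexp_conditional (gen j) (gens gen (predC1 j)) _ _ _ _ D) => //.
  - exact: gens_measurable.
  - exact: indep_gens.
  - exact: adapted_sub (au j).
  - apply: measurable_funD; last exact: adapted_sub af.
    rewrite (_ : (fun _ => _) = (fun w => \sum_(i <- s | i \in s) Y i w * u i w)).
      apply: measurable_sum_cond => i si; apply: measurable_funM.
        by apply: aY'; apply: contraNneq js => <-.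
      exact: adapted_sub (au i).
    by apply/funext => w; rewrite big_seq.
  - exact: Yrho.
have -> : (fun w => \sum_(i <- j :: s) rho i (u i w) + f w) =
    (fun w => \sum_(i <- s) rho i (u i w) + (rho j (u j w) + f w)).
  by apply/funext => w; rewrite big_cons addrAC [LHS]addrC.
apply: IHs => //; first by move=> i si; apply: sS; rewrite inE si orbT.
by apply: measurable_funD; [exact: measurableT_comp (au j)|exact: af].
Qed.

(** The chain with multipliers constantly 1, so that [D] shrinks to a point and each [rho j] is a
    constant. *)
Lemma Eexp_sum_le (X : I -> T -> R) (c : I -> R) :
  (forall j, adapted (gen j) (X j)) ->
  (forall j, (Eexp (X j) <= (expR (c j))%:E)%E) ->
  (Eexp (fun w => \sum_j X j w)%R <= (expR (\sum_j c j))%:E)%E.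
Proof.
move=> aX Xc.
have := @Eexp_chain (index_enum I) pred0 X (fun=> cst 1) (cst 0) (fun j => cst (c j))
  [set 1] (index_enum_uniq _).
have -> : (fun w => \sum_j X j w * cst 1 w + cst 0 w) = (fun w => \sum_j X j w).
  by apply/funext => w; rewrite addr0; apply: eq_bigr => j _; rewrite mulr1.
have -> : (fun w : T => \sum_j cst (c j) (cst 1 w : R) + cst 0 w) = (fun=> \sum_j c j).
  by apply/funext => w; rewrite addr0.
rewrite Eexp_cst; apply => //.
- by move=> j; exact: measurable_cst.
- exact: measurable_cst.
- move=> j r /= ->; rewrite (_ : (fun _ => _) = X j)//.
  by apply/funext => w; rewrite mulr1.
Qed.

End chain.
End exponential_moment.

(** * Bilinear forms of subgaussian variables *)

Section bilinear_forms.
Context {R : realType} {n : nat}.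
Implicit Types (B : 'I_n -> 'I_n -> R) (x y p q : 'I_n -> R) (b : R).

(* b bounds the square of the operator norm of B. *)
Definition opbound B b := forall x,
  \sum_i (\sum_j B i j * x j) ^+ 2 <= b * \sum_j x j ^+ 2.

Definition frob2 B : R := \sum_i \sum_j B i j ^+ 2.

(** With y = B^T x, |y|^2 = <x, B y> <= (b |x|^2 + |B y|^2 / b) / 2, and |B y|^2 <= b |y|^2 lets
    half of |y|^2 be absorbed. No division by |y| occurs. *)
Lemma opbound_tr B b : 0 < b -> opbound B b -> opbound (fun i j => B j i) b.
Proof.
move=> b0 hB x; set y := fun i => \sum_j B j i * x j.
have yy : \sum_i y i ^+ 2 = \sum_j x j * \sum_i B j i * y i.
  under eq_bigr => i _ do rewrite expr2 {1}/y mulr_suml.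
  rewrite exchange_big/=; apply: eq_bigr => j _; rewrite mulr_sumr.
  by apply: eq_bigr => i _; ring.
have key : \sum_j x j * \sum_i B j i * y i <=
    2^-1 * (b * \sum_j x j ^+ 2 + b^-1 * \sum_j (\sum_i B j i * y i) ^+ 2).
  rewrite !mulr_sumr -big_split/= mulr_sumr; apply: ler_sum => j _.
  set z := \sum_i _.
  have : 0 <= b^-1 * (b * x j - z) ^+ 2 by rewrite mulr_ge0 ?sqr_ge0// invr_ge0 ltW.
  have -> : b^-1 * (b * x j - z) ^+ 2 = b * x j ^+ 2 - 2 * (x j * z) + b^-1 * z ^+ 2.
    by field; rewrite gt_eqF.
  lra.
have : b^-1 * \sum_j (\sum_i B j i * y i) ^+ 2 <= \sum_i y i ^+ 2.
  by rewrite ler_pdivrMl// hB.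
rewrite -/(y _); move: key; rewrite -yy; lra.
Qed.

Lemma opbound_row B b i : 0 < b -> opbound B b -> \sum_j B i j ^+ 2 <= b.
Proof.
move=> b0 hB; have := opbound_tr b0 hB (fun k => (k == i)%:R).
have e (F : 'I_n -> R) : \sum_k F k * (k == i)%:R = F i.
  rewrite (bigD1 i)//= eqxx mulr1 big1 ?addr0// => k /negbTE ->.
  by rewrite mulr0.
under eq_bigr => j _ do rewrite e.
under [in leRHS]eq_bigr => j _ do rewrite expr2.
by rewrite e eqxx mulr1.
Qed.

Lemma opbound_entry B b i j : 0 < b -> opbound B b -> B i j ^+ 2 <= b.
Proof.
move=> b0 hB; apply: le_trans (opbound_row i b0 hB).
by rewrite (bigD1 j)//= lerDl sumr_ge0// => k _; rewrite sqr_ge0.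
Qed.

Lemma opbound_scale B b r : opbound B b -> opbound (fun i j => r * B i j) (r ^+ 2 * b).
Proof.
move=> hB x; under eq_bigr => i _.
  under eq_bigr => j _ do rewrite -mulrA.
  rewrite -mulr_sumr exprMn; over.
by rewrite -mulr_sumr -mulrA ler_wpM2l ?sqr_ge0// hB.
Qed.

(** Serves twice: with indicators of a subset and of its complement after decoupling, and with
    frozen Bernoulli values after conditioning. *)
Lemma opbound_mask B b p q : 0 <= b -> (forall i, p i ^+ 2 <= 1) ->
  (forall j, q j ^+ 2 <= 1) -> opbound B b -> opbound (fun i j => p i * q j * B i j) b.
Proof.
move=> b0 hp hq hB x.
apply: (@le_trans _ _ (\sum_i (\sum_j B i j * (q j * x j)) ^+ 2)).
  apply: ler_sum => i _.
  have -> : \sum_j p i * q j * B i j * x j = p i * \sum_j B i j * (q j * x j).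
    by rewrite mulr_sumr; apply: eq_bigr => j _; ring.
  by rewrite exprMn ler_piMl ?sqr_ge0.
apply: le_trans (hB _) _; rewrite ler_wpM2l//; apply: ler_sum => j _.
by rewrite exprMn ler_piMl ?sqr_ge0.
Qed.

(** The matrix B B^T, which represents x -> |B^T x|^2 as a quadratic form. *)
Definition gram B i j := \sum_k B i k * B j k.

Lemma gram_diag_sum B : \sum_i gram B i i = frob2 B.
Proof. by apply: eq_bigr => i _; apply: eq_bigr => j _; rewrite expr2. Qed.

Lemma sum_sqr_gram B x :
  \sum_k (\sum_i B i k * x i) ^+ 2 = \sum_i \sum_j gram B i j * x i * x j.
Proof.
under eq_bigr => k _ do rewrite expr2 mulr_suml.
rewrite exchange_big/=; apply: eq_bigr => i _.
under eq_bigr => k _ do rewrite mulr_sumr.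
rewrite exchange_big/=; apply: eq_bigr => j _.
by rewrite /gram !mulr_suml; apply: eq_bigr => k _; ring.
Qed.

Lemma opbound_gram B b : 0 < b -> opbound B b -> opbound (gram B) (b ^+ 2).
Proof.
move=> b0 hB x.
have e i : \sum_j gram B i j * x j = \sum_k B i k * \sum_j B j k * x j.
  under eq_bigr => j _ do rewrite mulr_suml.
  rewrite exchange_big/=; apply: eq_bigr => k _.
  by rewrite mulr_sumr; apply: eq_bigr => j _; ring.
under eq_bigr => i _ do rewrite e.
by apply: le_trans (hB _) _; rewrite expr2 -mulrA ler_wpM2l ?(ltW b0)// opbound_tr.
Qed.

(** Column j of B B^T is B applied to row j of B, so [opbound] is used once per column. *)
Lemma frob2_gram B b : opbound B b -> frob2 (gram B) <= b * frob2 B.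
Proof.
move=> hB; rewrite /frob2 exchange_big mulr_sumr; apply: ler_sum => j _.
exact: hB.
Qed.

Lemma sum_offdiag B :
  \sum_i \sum_j B i j = \sum_i B i i + \sum_i \sum_(j | i != j) B i j.
Proof.
rewrite -big_split/=; apply: eq_bigr => i _; rewrite (bigD1 i)//=.
by congr (_ + _); apply: eq_bigl => j; rewrite eq_sym.
Qed.

End bilinear_forms.

Section subgaussian_forms.
Context {d} {T : measurableType d} {R : realType} (P : probability T R) {n : nat}.
Variable gen : 'I_n -> set (set T).
Hypothesis genm : forall i, gen i `<=` measurable.
Hypothesis ind : indep_sigma P (fun i => <<s gen i >>).
Implicit Types (X Y : 'I_n -> T -> R) (B : 'I_n -> 'I_n -> R).

(* 36 is the value that the moment bounds of psi_2 yield at norm at most 1. *)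
Definition subgaussian (X : T -> R) :=
  (forall s, (Eexp P (fun w => X w * s)%R <= (expR (36 * s ^+ 2))%:E)%E) /\
  (forall s, 0 <= s <= 16^-1 ->
    (Eexp P (fun w => X w ^+ 2 * s)%R <= (expR (36 * s))%:E)%E).

Let adm X : (forall i, adapted (gen i) (X i)) -> forall i, measurable_fun setT (X i).
Proof. by move=> aX i; apply: adapted_measurable (aX i). Qed.

(** Decoupling turns the factor 2 into 8. Integrating out [Y j] for [j] outside [L] gives
    [36 * s ^+ 2] at s = sum of 8 B_ij X_i over [L], the square of 6 * 8 = 48 times the sum. [X j]
    and [Y j] may be dependent, since only indices in [L] survive in [X]. *)
Lemma Eexp_offdiag B X Y (M : R) :
  (forall i, adapted (gen i) (X i)) -> (forall i, adapted (gen i) (Y i)) ->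
  (forall i, subgaussian (Y i)) ->
  (forall L : {set 'I_n}, (Eexp P (fun w => \sum_j (\sum_i
     (i \in L)%:R * (j \notin L)%:R * (48 * B i j) * X i w) ^+ 2)%R <= M%:E)%E) ->
  (Eexp P (fun w => 2 * \sum_i \sum_(j | i != j) B i j * X i w * Y j w)%R <= M%:E)%E.
Proof.
move=> aX aY sY hM; have mX := adm aX; have mY := adm aY.
under eq_fun => w.
  rewrite mulr_sumr; under eq_bigr => i _ do rewrite mulr_sumr; over.
apply: (@Eexp_decoupling _ _ _ P n (fun i j w => 2 * (B i j * X i w * Y j w))).
  by move=> i j; do 3!apply: measurable_funM => //.
move=> L; apply: le_trans (hM L).
pose u j w := \sum_(i in L) 8 * B i j * X i w.
pose s := [seq j <- index_enum 'I_n | j \notin L].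
have := @Eexp_chain _ _ _ P _ gen genm ind s (mem L) Y u (cst 0)
  (fun=> fun r => 36 * r ^+ 2) setT.
have -> : (fun w => \sum_(j <- s) Y j w * u j w + cst 0 w) =
    (fun w => 4 * \sum_(i in L) \sum_(j | j \notin L) 2 * (B i j * X i w * Y j w)).
  apply/funext => w; rewrite addr0 /s big_filter exchange_big/= mulr_sumr.
  apply: eq_bigr => j _; rewrite /u !mulr_sumr; apply: eq_bigr => i _; ring.
have -> : (fun w => \sum_(j <- s) 36 * (u j w) ^+ 2 + cst 0 w) =
    (fun w => \sum_j (\sum_i
     (i \in L)%:R * (j \notin L)%:R * (48 * B i j) * X i w) ^+ 2).
  apply/funext => w; rewrite addr0 /s big_filter big_mkcond/=.
  apply: eq_bigr => j _; case: ifPn => jL.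
    have -> : 36 * u j w ^+ 2 = (6 * u j w) ^+ 2 by ring.
    congr (_ ^+ 2); rewrite /u mulr_sumr big_mkcond; apply: eq_bigr => i _.
    by case: ifPn => iL /=; ring.
  by rewrite big1 ?expr0n// => i _; rewrite mulr0 !mul0r.
apply.
- by rewrite filter_uniq// index_enum_uniq.
- by move=> j; rewrite mem_filter => /andP[].
- exact: aY.
- move=> j; apply: measurable_sum_cond => i iL; apply: measurable_funM => //.
  by apply: adapted_sub (aX i); exact: gen_sub_gens.
- exact: measurable_cst.
- by move=> j; apply: measurable_funM => //; exact: measurable_funX.
- by [].
- by move=> j r _; have [+ _] := sY j; exact.
Qed.

Lemma Eexp_sum_sqr_le X (c : 'I_n -> R) :
  (forall i, adapted (gen i) (X i)) -> (forall i, subgaussian (X i)) ->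
  (forall i, 0 <= c i <= 16^-1) ->
  (Eexp P (fun w => \sum_i X i w ^+ 2 * c i)%R <= (expR (36 * \sum_i c i))%:E)%E.
Proof.
move=> aX sX c01; rewrite mulr_sumr.
apply: (Eexp_sum_le genm ind) => i; last by have [_ +] := sX i; exact.
by apply: measurable_funM => //; apply: measurable_funX; exact: aX.
Qed.

(* Bootstrapping: the off-diagonal part of |B^T X|^2 is, after decoupling,
   again of the form |B'^T X|^2 with B' no larger than B, and enters with
   weight 1/2; a crude bound therefore improves by a factor 2 at each round. *)
Lemma Eexp_sqr_form_iter X (b : R) k : (forall i, adapted (gen i) (X i)) ->
  (forall i, subgaussian (X i)) -> 0 < b -> 48 ^+ 2 * b <= 1 ->
  forall B, opbound B b ->
  (Eexp P (fun w => \sum_j (\sum_i B i j * X i w) ^+ 2)%R <=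
   (expR (72 * frob2 B + 36 * b * n%:R * 2^-1 ^+ k))%:E)%E.
Proof.
move=> aX sX b0 b1; have mX := adm aX.
have mlin B' j : measurable_fun setT (fun w => \sum_i B' i j * X i w).
  by apply: measurable_sum_cond => i _; exact: measurable_funM.
elim: k => [|k IHk] B hB.
  (* The crude starting bound |B^T X|^2 <= b |X|^2, whose exponent grows with the dimension. *)
  apply: (@le_trans _ _ (Eexp P (fun w => \sum_i X i w ^+ 2 * b)%R)).
    apply: le_Eexp.
    - by apply: measurable_sum_cond => j _; apply: measurable_funX; exact: mlin.
    - apply: measurable_sum_cond => i _; apply: measurable_funM => //.
      exact: measurable_funX.
    - by move=> w; rewrite -mulr_suml mulrC; exact: (opbound_tr b0 hB).
  apply: (le_trans (Eexp_sum_sqr_le aX sX _)); first by move=> i; lra.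
  rewrite lee_fin ler_expR sumr_const card_ord -[b *+ n]mulr_natr expr0 mulr1 mulrA lerDr.
  by rewrite mulr_ge0// sumr_ge0// => i _; rewrite sumr_ge0// => j _; rewrite sqr_ge0.
set c := 36 * b * _ in IHk *.
have -> : (fun w => \sum_j (\sum_i B i j * X i w) ^+ 2) =
   (fun w => \sum_i X i w ^+ 2 * gram B i i +
      \sum_i \sum_(j | i != j) gram B i j * X i w * X j w).
  apply/funext => w; rewrite sum_sqr_gram sum_offdiag; congr (_ + _).
  by apply: eq_bigr => i _; ring.
(* The diagonal of the Gram matrix pays 36 [frob2 B]; the off-diagonal part pays half of the
   previous bound. This halves the dimensional term and reproduces 72. *)
have -> : 72 * frob2 B + c * 2^-1 ^+ k.+1 =
    36 * frob2 B + 2^-1 * (72 * frob2 B + c * 2^-1 ^+ k).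
  by rewrite exprS; field.
apply: EexpD_le.
- apply: measurable_sum_cond => i _; apply: measurable_funM => //.
  exact: measurable_funX.
- do 2!(apply: measurable_sum_cond => ? _).
  by do 2!apply: measurable_funM => //.
- have := @Eexp_sum_sqr_le X (fun i => 2 * gram B i i) aX sX.
  rewrite -mulr_sumr gram_diag_sum mulrCA.
  have -> : (fun w => \sum_i X i w ^+ 2 * (2 * gram B i i)) =
     (fun w => 2 * \sum_i X i w ^+ 2 * gram B i i).
    by apply/funext => w; rewrite mulr_sumr; apply: eq_bigr => i _; ring.
  apply => i; have := opbound_row i b0 hB.
  have -> : \sum_j B i j ^+ 2 = gram B i i by apply: eq_bigr => j _; rewrite expr2.
  have : 0 <= gram B i i by apply: sumr_ge0 => j _; rewrite -expr2 sqr_ge0.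
  lra.
- rewrite mulrA divff// mul1r.
  apply: Eexp_offdiag => // L.
  set B' := fun i j : 'I_n => (i \in L)%:R * (j \notin L)%:R * (48 * gram B i j).
  (* Smallness of [b] closes the induction: [B'] satisfies [opbound] with the same [b], and by
     [frob2_gram] its Frobenius norm does not exceed that of [B]. *)
  have b2 : 48 ^+ 2 * b ^+ 2 <= b.
    by rewrite [b ^+ 2]expr2 mulrA -[leRHS]mul1r ler_wpM2r// ltW.
  have bool_sqr (e : bool) : (e%:R : R) ^+ 2 <= 1 by case: e; rewrite ?expr1n ?expr0n.
  have hB' : opbound B' b.
    apply: opbound_mask => //; first exact: ltW.
    move=> x; apply: le_trans (opbound_scale _ (opbound_gram b0 hB) x) _.
    by rewrite ler_wpM2r// sumr_ge0// => j _; rewrite sqr_ge0.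
  apply: le_trans (IHk _ hB') _; rewrite lee_fin ler_expR lerD2r ler_wpM2l//.
  have f0 : 0 <= frob2 B.
    by rewrite sumr_ge0// => i _; rewrite sumr_ge0// => j _; rewrite sqr_ge0.
  apply: (@le_trans _ _ (48 ^+ 2 * frob2 (gram B))).
    rewrite /frob2 mulr_sumr; apply: ler_sum => i _.
    rewrite mulr_sumr; apply: ler_sum => j _.
    rewrite /B' -exprMn [leLHS]exprMn ler_piMl ?sqr_ge0// exprMn.
    by rewrite mulr_ile1 ?sqr_ge0.
  apply: (@le_trans _ _ (48 ^+ 2 * (b * frob2 B))).
    by rewrite ler_wpM2l ?sqr_ge0// frob2_gram.
  by rewrite mulrA -[leRHS]mul1r ler_wpM2r.
Qed.

(** Let k tend to infinity in the iterated bound; its case k = 0 makes the moment finite, so the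
    limit is taken in the reals. *)
Lemma Eexp_sqr_form X (b : R) B : (forall i, adapted (gen i) (X i)) ->
  (forall i, subgaussian (X i)) -> 0 < b -> 48 ^+ 2 * b <= 1 -> opbound B b ->
  (Eexp P (fun w => \sum_j (\sum_i B i j * X i w) ^+ 2)%R <=
   (expR (72 * frob2 B))%:E)%E.
Proof.
move=> aX sX b0 b1 hB.
have h k := Eexp_sqr_form_iter k aX sX b0 b1 hB.
set E := Eexp _ _ in h *.
have Efin : E \is a fin_num.
  by rewrite ge0_fin_numE ?Eexp_ge0// (le_lt_trans (h 0%N)) ?ltry.
rewrite -(fineK Efin) lee_fin.
have cv : expR (72 * frob2 B + 36 * b * n%:R * 2^-1 ^+ k) @[k --> \oo] -->
    expR (72 * frob2 B).
  apply: continuous_cvg; first exact: continuous_expR.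
  rewrite -[X in _ --> X]addr0; apply: cvgD; first exact: cvg_cst.
  rewrite -(mulr0 (36 * b * n%:R)); apply: cvgM; first exact: cvg_cst.
  by apply: cvg_expr; rewrite ger0_norm// invf_lt1// ltr1n.
rewrite -(cvg_lim _ cv)//; apply: limr_ge; first by apply/cvg_ex; eexists; exact: cv.
by apply: nearW => k; rewrite -lee_fin fineK.
Qed.

(** [Eexp_offdiag] yields a masked matrix with bound 48^2 b, and [Eexp_sqr_form] asks for another
    factor 48^2, hence 48^4. The mask vanishes for i = j, so the diagonal of [B] does not enter. *)
Lemma Eexp_offdiag_form X Y (b : R) B : (forall i, adapted (gen i) (X i)) ->
  (forall i, adapted (gen i) (Y i)) ->
  (forall i, subgaussian (X i)) -> (forall i, subgaussian (Y i)) ->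
  0 < b -> 48 ^+ 4 * b <= 1 -> opbound B b ->
  (Eexp P (fun w => 2 * \sum_i \sum_(j | i != j) B i j * X i w * Y j w)%R <=
   (expR (72 * 48 ^+ 2 * \sum_i \sum_(j | i != j) B i j ^+ 2))%:E)%E.
Proof.
move=> aX aY sX sY b0 b1 hB; apply: Eexp_offdiag => // L.
set B' := fun i j : 'I_n => (i \in L)%:R * (j \notin L)%:R * (48 * B i j).
have b0' : 0 < 48 ^+ 2 * b by rewrite mulr_gt0.
have bool_sqr (e : bool) : (e%:R : R) ^+ 2 <= 1 by case: e; rewrite ?expr1n ?expr0n.
have hB' : opbound B' (48 ^+ 2 * b).
  by apply: opbound_mask => //; [exact: ltW|exact: opbound_scale].
apply: le_trans (Eexp_sqr_form aX sX b0' _ hB') _; first by rewrite mulrA -exprD.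
rewrite lee_fin ler_expR -mulrA ler_wpM2l// /frob2 mulr_sumr.
apply: ler_sum => i _; rewrite mulr_sumr [leRHS]big_mkcond/=; apply: ler_sum => j _.
rewrite /B'; case: ifPn => [ij|].
  rewrite -exprMn [leLHS]exprMn ler_piMl ?sqr_ge0// exprMn.
  by rewrite mulr_ile1 ?sqr_ge0.
by rewrite negbK => /eqP ->; case: (j \in L); rewrite !(mulr0, mul0r) expr0n.
Qed.

End subgaussian_forms.

(** * From the psi_2 norm to exponential moments *)

Section psi2_subgaussian.
Context {d} {T : measurableType d} {R : realType} (P : probability T R).
Implicit Types (X : T -> R) (K : R).

Lemma psi2norm_moment X K k : 0 < K -> (0 < k)%N -> (psi2norm P X <= K%:E)%E ->
  (\int[P]_w (X w ^+ k.*2)%:E <= (K ^+ k.*2 * k.*2%:R ^+ k)%:E)%E.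
Proof.
move=> K0 k0 hX; set p : R := k.*2%:R.
have p1 : 1 <= p by rewrite ler1n double_gt0.
have p0 : 0 < p by apply: lt_le_trans p1.
have := le_trans (ereal_sup_ubound _) hX => /(_ _ (ex_intro2 _ _ p p1 erefl)).
rewrite unlock.
have -> : (\int[P]_w (`|X w| `^ p)%:E = \int[P]_w (X w ^+ k.*2)%:E)%E.
  apply: eq_integral => w _; congr EFin; rewrite powR_mulrn//.
  by rewrite -mul2n !exprM real_normK ?num_real.
have : (0 <= \int[P]_w (X w ^+ k.*2)%:E)%E.
  by apply: integral_ge0 => w _; rewrite lee_fin -mul2n exprM exprn_ge0// sqr_ge0.
have sp0 : 0 < Num.sqrt p by rewrite sqrtr_gt0.
(* An infinite moment would have an infinite root, against the finite bound [K]. *)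
case: (\int[P]_w _)%E => [r||//] r0; last first.
  by rewrite poweRyr ?invr_eq0 ?gt_eqF// gt0_mulye ?lte_fin ?invr_gt0.
rewrite poweR_EFin -EFinM !lee_fin ler_pdivrMr// => h.
have : (r `^ p^-1) `^ p <= (K * Num.sqrt p) `^ p.
  by rewrite ge0_ler_powR ?nnegrE ?powR_ge0 ?mulr_ge0// ltW.
rewrite -powRrM mulVf ?gt_eqF// powRr1// => /le_trans; apply.
rewrite powR_mulrn ?mulr_ge0 ?(ltW sp0) ?(ltW K0)// exprMn -(mul2n k) !exprM.
by rewrite sqr_sqrtr ?(ltW p0)// /p mul2n.
Qed.

(** One Taylor term of the exponential gives k^k / k! <= e^k, and e <= 4 is precise enough. *)
Lemma natX_le_fact k : (k%:R ^+ k : R) <= 4 ^+ k * k`!%:R.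
Proof.
have e4 : expR 1 <= (4 : R).
  have h := expR_ge1Dx (- 2^-1 : R); have h1 := expRxMexpNx_1 (2^-1 : R).
  have h0 := expR_gt0 (2^-1 : R).
  have h2 : expR 2^-1 <= (2 : R) by nra.
  have -> : (1 : R) = 2^-1 + 2^-1 by lra.
  by rewrite expRD; nra.
case: k => [|k]; first by rewrite !expr0 mul1r.
have := @expR_ge1Dxn R k.+1%:R k (ler0n _ _).
have f0 : (0 : R) < k.+1`!%:R by rewrite ltr0n fact_gt0.
move=> h; rewrite -ler_pdivrMr//.
apply: (@le_trans _ _ (expR k.+1%:R)); first by lra.
rewrite -[k.+1%:R]mulr1 expRM_natl; apply: lerXn2r; rewrite ?nnegrE ?expR_ge0//.
Qed.

Lemma expR_nneseries (x : R) : 0 <= x ->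
  (\sum_(0 <= k <oo) (x ^+ k / k`!%:R)%:E = (expR x)%:E)%E.
Proof.
move=> x0; rewrite /expR -EFin_lim; last exact: is_cvg_series_exp_coeff.
by apply/congr_lim/funext => n/=; rewrite /series/= -sumEFin.
Qed.

(** By the moment bound, the k-th term of the exponential series has mean at most (2s)^k k^k / k! <=
    (8s)^k, and the geometric sum 1 / (1 - 8s) is at most 1 + 16s when s <= 1/16. *)
Lemma Eexp_sqr_le X K (s : R) : measurable_fun setT X -> 0 < K ->
  (psi2norm P X <= K%:E)%E -> 0 <= s <= 16^-1 ->
  (Eexp P (fun w => (X w / K) ^+ 2 * s)%R <= (expR (16 * s))%:E)%E.
Proof.
move=> mX K0 hX /andP[s0 s1].
have [->|sn0] := eqVneq s 0.
  by rewrite mulr0; under eq_fun do rewrite mulr0; rewrite Eexp_cst.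
have {}s0 : 0 < s by rewrite lt_def sn0.
have ms k : measurable_fun setT (fun w => (((X w / K) ^+ 2 * s) ^+ k / k`!%:R)%:E).
  apply/measurable_EFinP; apply: measurable_funM => //; apply: measurable_funX.
  by apply: measurable_funM => //; apply: measurable_funX; exact: measurable_funM.
have s_ge0 k w : 0 <= ((X w / K) ^+ 2 * s) ^+ k / k`!%:R.
  by rewrite divr_ge0// exprn_ge0// mulr_ge0 ?sqr_ge0// ltW.
have -> : Eexp P (fun w => (X w / K) ^+ 2 * s) =
    (\int[P]_w \sum_(0 <= k <oo) (((X w / K) ^+ 2 * s) ^+ k / k`!%:R)%:E)%E.
  apply: eq_integral => w _; rewrite expR_nneseries//.
  by rewrite mulr_ge0 ?sqr_ge0// ltW.
rewrite integral_nneseries//; last by move=> k w _; rewrite lee_fin.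
apply: lime_le.
  by apply: is_cvg_nneseries => k _ _; apply: integral_ge0 => w _; rewrite lee_fin.
apply: nearW => N /=.
have term k : (\int[P]_w (((X w / K) ^+ 2 * s) ^+ k / k`!%:R)%:E <= ((8 * s) ^+ k)%:E)%E.
  have [->|k0] := posnP k.
    under eq_integral do rewrite !expr0 fact0 divr1.
    by have := integral_cst P measurableT 1%E; rewrite /= probability_setT mule1 => ->.
  have c0 : 0 <= s ^+ k / (K ^+ k.*2 * k`!%:R).
    by rewrite divr_ge0 ?mulr_ge0 ?exprn_ge0// ltW.
  have -> : (\int[P]_w (((X w / K) ^+ 2 * s) ^+ k / k`!%:R)%:E)%E =
      ((s ^+ k / (K ^+ k.*2 * k`!%:R))%:E * \int[P]_w (X w ^+ k.*2)%:E)%E.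
    rewrite -ge0_integralZl//; last 2 first.
    - by apply/measurable_EFinP; exact: measurable_funX.
    - by move=> w _; rewrite lee_fin -mul2n exprM exprn_ge0// sqr_ge0.
    apply: eq_integral => w _; rewrite -EFinM; congr EFin.
    rewrite exprMn -exprM mul2n expr_div_n; field.
    by rewrite expf_neq0 ?gt_eqF//= pnatr_eq0 -lt0n fact_gt0.
  apply: (le_trans (lee_wpmul2l _ (psi2norm_moment K0 k0 hX))); first by rewrite lee_fin.
  have Kk : K ^+ k.*2 != 0 by rewrite expf_neq0 ?gt_eqF.
  have fk : (k`!%:R : R) != 0 by rewrite pnatr_eq0 -lt0n fact_gt0.
  rewrite -EFinM lee_fin.
  have -> : s ^+ k / (K ^+ k.*2 * k`!%:R) * (K ^+ k.*2 * k.*2%:R ^+ k) =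
     (2 * s) ^+ k * (k%:R ^+ k / k`!%:R).
    by rewrite -mul2n natrM !exprMn; field; rewrite fk expf_neq0 ?gt_eqF.
  have -> : (8 * s) ^+ k = (2 * s) ^+ k * 4 ^+ k by rewrite -exprMn; congr (_ ^+ _); ring.
  rewrite ler_wpM2l ?exprn_ge0 ?mulr_ge0 ?(ltW s0)//.
  by rewrite ler_pdivrMr ?natX_le_fact// ltr0n fact_gt0.
apply: (@le_trans _ _ (\sum_(0 <= k < N) ((8 * s) ^+ k)%:E)%E).
  by apply: lee_sum => k _; exact: term.
rewrite sumEFin lee_fin.
have r1 : `|8 * s| < 1 by rewrite ger0_norm; lra.
have r0 : 0 < 8 * s by lra.
have := @geometric_le_lim R N 1 (8 * s) ler01 r0 r1.
rewrite /series/= /geometric/=; under eq_bigr do rewrite mul1r.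
move=> /le_trans; apply.
have h := expR_ge1Dx (16 * s).
apply: le_trans h; rewrite ler_pdivrMr; nra.
Qed.

(** [V] carries the first-order part and integrates to zero; if the integral of [h] is infinite the
    bound is trivial. *)
Lemma Eexp_le_centered (V h f : T -> R) : P.-integrable setT (EFin \o V) ->
  (\int[P]_w (V w)%:E = 0)%E -> measurable_fun setT f -> measurable_fun setT h ->
  (forall w, 0 <= h w) -> (forall w, expR (f w) <= V w + h w) ->
  (Eexp P f <= \int[P]_w (h w)%:E)%E.
Proof.
move=> iV V0 mf mh h0 fVh.
have [->|hfin] := eqVneq (\int[P]_w (h w)%:E)%E +oo%E; first exact: leey.
have ih : P.-integrable setT (EFin \o h).
  apply/integrableP; split; first exact/measurable_EFinP.
  under eq_integral do rewrite /= ger0_norm//.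
  by rewrite ltey.
have mV : measurable_fun setT V by apply/measurable_EFinP; exact: measurable_int iV.
apply: (@le_trans _ _ (\int[P]_w ((V w)%:E + (h w)%:E))%E).
  apply: ge0_le_integral => //.
  - exact: measurable_EexpR.
  - by apply: emeasurable_funD; exact/measurable_EFinP.
  - by move=> w _; rewrite -EFinD lee_fin.
by rewrite integralD// V0 add0e.
Qed.

Lemma subgaussian_psi2 X K : measurable_fun setT X -> 0 < K ->
  ('E_P[X] = 0)%E -> (psi2norm P X <= K%:E)%E ->
  subgaussian P (fun w => X w / K).
Proof.
move=> mX K0 EX0 hX.
have mXK : measurable_fun setT (fun w => X w / K) by exact: measurable_funM.
have sq s : 0 <= s <= 16^-1 ->
    (Eexp P (fun w => (X w / K) ^+ 2 * s)%R <= (expR (16 * s))%:E)%E.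
  exact: Eexp_sqr_le.
split=> s; last first.
  move=> /[dup] /andP[s0 _] /sq /le_trans; apply.
  by rewrite lee_fin ler_expR ler_wpM2r//; lra.
have mXs : measurable_fun setT (fun w => X w / K * s) by exact: measurable_funM.
have mX2 r : measurable_fun setT (fun w => (X w / K) ^+ 2 * r).
  by apply: measurable_funM => //; exact: measurable_funX.
have s20 : 0 <= s ^+ 2 by exact: sqr_ge0.
(* Origin of 36. For small s, E exp (s X) <= E exp (2 s^2 X^2) <= exp (32 s^2). For large s, s X <=
   X^2 / 16 + 4 s^2 gives exp (1 + 4 s^2), and 1 < 32 s^2. *)
have [s1|s1] := leP (2 * s ^+ 2) 16^-1.
  (* A zero expectation alone does not yield integrability here; it comes from the exponential
     moment of the square. *)
  have iX : P.-integrable setT (EFin \o X).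
    have : P.-integrable setT (fun w => (16 * (K * expR ((X w / K) ^+ 2 * 16^-1)))%:E).
      apply/integrableP; split.
        apply/measurable_EFinP; do 2!apply: measurable_funM => //.
        by apply: measurableT_comp => //.
      under eq_integral => w _.
        rewrite abse_EFin ger0_norm; last by rewrite !mulr_ge0// ltW.
        rewrite mulrA EFinM; over.
      rewrite ge0_integralZl//; last 2 first.
      - exact: measurable_EexpR.
      - by rewrite lee_fin mulr_ge0// ltW.
      rewrite lte_mul_pinfty// ?lee_fin ?mulr_ge0 ?(ltW K0)//.
      apply: le_lt_trans (sq 16^-1 _) (ltry _); lra.
    apply: le_integrable => //; first exact/measurable_EFinP.
    move=> w _ /=; rewrite lee_fin [leRHS]ger0_norm; last by rewrite !mulr_ge0// ltW.
    have -> : `|X w| = K * `|X w / K|.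
      by rewrite normrM normfV (gtr0_norm K0) mulrCA divff ?mulr1 ?gt_eqF.
    rewrite mulrCA ler_wpM2l ?(ltW K0)//.
    have h1 := expR_ge1Dx ((X w / K) ^+ 2 * 16^-1).
    have h2 : `|X w / K| <= 1 + (X w / K) ^+ 2.
      by rewrite -real_normK ?num_real//; nra.
    have := sqr_ge0 (X w / K); lra.
  have iXs : P.-integrable setT (EFin \o (fun w => X w / K * s)).
    have := integrableZl measurableT (s / K) iX.
    by congr (P.-integrable setT _); apply/funext => w /=; rewrite -EFinM; congr EFin; ring.
  apply: (le_trans (Eexp_le_centered (V := fun w => X w / K * s)
    (h := fun w => expR ((X w / K) ^+ 2 * (2 * s ^+ 2))) iXs _ mXs _ _ _)) => //.
  - have -> : (fun w => (X w / K * s)%:E) = (fun w => (s / K)%:E * (X w)%:E)%E.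
      by apply/funext => w; rewrite -EFinM; congr EFin; ring.
    rewrite integralZl//.
    by move: EX0; rewrite unlock => ->; rewrite mule0.
  - exact: measurableT_comp.
  - move=> w; have := expR_le_add_expR_sqr (X w / K * s).
    by rewrite exprMn (mulrCA 2) .
  apply: le_trans (sq _ _) _; first by lra.
  by rewrite lee_fin ler_expR; lra.
apply: (@le_trans _ _ (Eexp P (fun w => (X w / K) ^+ 2 * 16^-1 + 4 * s ^+ 2)%R)).
  apply: le_Eexp => //; first exact: measurable_funD.
  move=> w; have := sqr_ge0 (X w / K * 4^-1 - 2 * s); lra.
apply: (le_trans (EexpD_cst_le _ _ (sq 16^-1 _))) => //; first by lra.
by rewrite lee_fin ler_expR; lra.
Qed.

End psi2_subgaussian.

(** * Products of two possibly dependent subgaussian variables *)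

Definition Cmean {R : realType} : R := 16 * expR 3.

Definition Cprod {R : realType} : R := 32 * 64 ^+ 2 * expR (Cmean / 32) * expR 3.

Section products.
Context {d} {T : measurableType d} {R : realType} (P : probability T R).
Variables X Y : T -> R.
Hypotheses (mX : measurable_fun setT X) (mY : measurable_fun setT Y).
Hypotheses (sX : subgaussian P X) (sY : subgaussian P Y).

Let mXY : measurable_fun setT (fun w => X w * Y w).
Proof. exact: measurable_funM. Qed.

Let mEXY : measurable_fun setT (fun w => `|X w * Y w| * 16^-1).
Proof. by apply: measurable_funM => //; exact: measurableT_comp. Qed.

(** |XY| / 16 <= X^2 / 32 + Y^2 / 32, then [EexpD_le], so correlation is allowed; 3 is 36/16 rounded
    up. *)
Lemma Eexp_norm_product :
  (Eexp P (fun w => (`|X w * Y w| * 16^-1)%R) <= (expR 3)%:E)%E.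
Proof.
have mX2 : measurable_fun setT (fun w => X w ^+ 2 * 32^-1).
  by apply: measurable_funM => //; exact: measurable_funX.
have mY2 : measurable_fun setT (fun w => Y w ^+ 2 * 32^-1).
  by apply: measurable_funM => //; exact: measurable_funX.
apply: (@le_trans _ _ (Eexp P (fun w => X w ^+ 2 * 32^-1 + Y w ^+ 2 * 32^-1)%R)).
  apply: le_Eexp => //; first exact: measurable_funD.
  move=> w; rewrite normrM -(real_normK (num_real (X w))) -(real_normK (num_real (Y w))).
  have := sqr_ge0 (`|X w| - `|Y w|); lra.
have e (Z : T -> R) : subgaussian P Z ->
    (Eexp P (fun w => (2 * (Z w ^+ 2 * 32^-1))%R) <= (expR (2 * (3 / 2)))%:E)%E.
  move=> [_ sZ].
  have -> : (fun w => 2 * (Z w ^+ 2 * 32^-1)) = (fun w => Z w ^+ 2 * 16^-1).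
    by apply/funext => w; lra.
  by apply: le_trans (sZ _ _) _; [lra|rewrite lee_fin ler_expR; lra].
apply: (le_trans (EexpD_le mX2 mY2 (e _ sX) (e _ sY))).
by rewrite lee_fin ler_expR; lra.
Qed.

Lemma integral_norm_product_le :
  (\int[P]_w (`|X w * Y w|)%:E <= (@Cmean R)%:E)%E.
Proof.
apply: (@le_trans _ _ (\int[P]_w (16%:E * (expR (`|X w * Y w| * 16^-1))%:E))%E).
  apply: ge0_le_integral => //.
  - by apply/measurable_EFinP; exact: measurableT_comp.
  - by apply: measurable_funeM; exact: measurable_EexpR.
  - move=> w _; rewrite -EFinM lee_fin.
    have := expR_ge1Dx (`|X w * Y w| * 16^-1); lra.
rewrite ge0_integralZl//; last exact: measurable_EexpR.
by rewrite EFinM lee_wpmul2l// Eexp_norm_product.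
Qed.

Lemma integrable_product : P.-integrable setT (EFin \o (fun w => X w * Y w)).
Proof.
apply/integrableP; split; first exact/measurable_EFinP.
by apply: le_lt_trans integral_norm_product_le _; rewrite ltry.
Qed.

Let m := fine (\int[P]_w (X w * Y w)%:E)%E.

Let mE : (\int[P]_w (X w * Y w)%:E)%E = m%:E.
Proof. by rewrite fineK// (integrable_fin_num _ integrable_product). Qed.

Lemma norm_mean_product : `|m| <= Cmean.
Proof.
rewrite -lee_fin; apply: le_trans integral_norm_product_le.
have := le_abse_integral P measurableT (measurable_int _ integrable_product).
by rewrite /= mE.
Qed.

(** Second-order Taylor at x = 2a(XY - m). Smallness of [a] gives |x| <= |XY - m| / 64; the factor
    x^2 is absorbed into one exponential and exp |x| is another, together exp (|XY - m| / 32),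
    integrable by [Eexp_norm_product]. Collecting factors gives [Cprod], with exp ([Cmean] / 32) the
    cost of the centering. *)
Lemma Eexp_centered_product (a : R) : `|a| <= 128^-1 ->
  (Eexp P (fun w => 2 * (a * (X w * Y w - m)))%R <= (expR (Cprod * a ^+ 2))%:E)%E.
Proof.
move=> a1.
pose K := 32 * 64 ^+ 2 * a ^+ 2 * expR (Cmean / 32).
have a20 : 0 <= a ^+ 2 by exact: sqr_ge0.
have K0 : 0 <= K by do 2!apply: mulr_ge0 => //.
have mV : measurable_fun setT (fun w => 2 * (a * (X w * Y w - m))).
  by do 2!apply: measurable_funM => //; exact: measurable_funB.
have iV : P.-integrable setT (EFin \o (fun w => 2 * (a * (X w * Y w - m)))).
  have := integrableZl measurableT (2 * a) (integrableB measurableT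
    integrable_product (finite_measure_integrable_cst P m measurableT)).
  congr (P.-integrable setT _); apply/funext => w /=.
  by rewrite -EFinB -EFinM mulrA.
apply: (@le_trans _ _ (\int[P]_w (1 + K * expR (`|X w * Y w| * 16^-1))%:E)%E).
  apply: (Eexp_le_centered iV) => //.
  - have -> : (fun w => (2 * (a * (X w * Y w - m)))%:E) =
        (fun w => (2 * a)%:E * ((X w * Y w)%:E - m%:E))%E.
      by apply/funext => w; rewrite -EFinB -EFinM mulrA.
    rewrite integralZl//; last first.
      apply: integrableB => //; first exact: integrable_product.
      exact: finite_measure_integrable_cst.
    rewrite integralB//; last 2 first.
    - exact: integrable_product.
    - exact: finite_measure_integrable_cst.
    rewrite mE; have := integral_cst P measurableT m%:E.
    by rewrite /= probability_setT mule1 => ->; rewrite subee// mule0.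
  - by apply: measurable_funD => //; apply: measurable_funM => //; exact: measurableT_comp.
  - by move=> w; rewrite addr_ge0// mulr_ge0.
  - move=> w; set V := X w * Y w - m; set x := 2 * (a * V).
    have hm := norm_mean_product.
    have hV : `|V| <= `|X w * Y w| + Cmean.
      by apply: (le_trans (ler_normB _ _)); rewrite lerD2l.
    apply: (le_trans (expR_le_taylor2 x)).
    rewrite [leLHS](_ : _ = x + (1 + 4 * x ^+ 2 * expR `|x|)); last by ring.
    rewrite lerD2l lerD2l.
    have V0 : 0 <= `|V| / 64 by rewrite divr_ge0.
    have h1 := sqr_le_2expR V0.
    have x2 : x ^+ 2 <= 4 * a ^+ 2 * (2 * 64 ^+ 2 * expR (`|V| / 64)).
      have -> : x ^+ 2 = 4 * a ^+ 2 * `|V| ^+ 2 by rewrite real_normK ?num_real// /x; ring.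
      rewrite ler_wpM2l//; first exact: mulr_ge0.
      have -> : `|V| ^+ 2 = 64 ^+ 2 * (`|V| / 64) ^+ 2 by field.
      lra.
    have hx : expR `|x| <= expR (`|V| / 64).
      rewrite ler_expR /x !normrM ger0_norm//.
      have := normr_ge0 V; nra.
    apply: (@le_trans _ _ (4 * (4 * a ^+ 2 * (2 * 64 ^+ 2 * expR (`|V| / 64))) *
        expR (`|V| / 64))).
      apply: ler_pM => //; last by rewrite ler_wpM2l.
      by rewrite mulr_ge0// sqr_ge0.
    have -> : 4 * (4 * a ^+ 2 * (2 * 64 ^+ 2 * expR (`|V| / 64))) * expR (`|V| / 64) =
        32 * 64 ^+ 2 * a ^+ 2 * expR (`|V| / 32).
      have -> : `|V| / 32 = `|V| / 64 + `|V| / 64 by field.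
      by rewrite expRD; ring.
    rewrite /K -[leRHS]mulrA ler_wpM2l//; first exact: mulr_ge0.
    rewrite -expRD ler_expR.
    have := normr_ge0 (X w * Y w); lra.
under eq_integral do rewrite EFinD EFinM.
have mexp : measurable_fun setT (fun w => (expR (`|X w * Y w| * 16^-1))%:E).
  exact: measurable_EexpR.
rewrite ge0_integralD//; last 2 first.
- by move=> w _; rewrite mule_ge0.
- exact: measurable_funeM.
rewrite ge0_integralZl//.
have := integral_cst P measurableT 1%E; rewrite /= probability_setT mule1 => ->.
apply: (@le_trans _ _ (1 + K%:E * (expR 3)%:E)%E).
  by rewrite leeD2l// lee_wpmul2l// Eexp_norm_product.
rewrite -EFinM -EFinD lee_fin.
apply: le_trans (expR_ge1Dx _); rewrite lerD2l /K /Cprod le_eqVlt; apply/orP; left.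
by apply/eqP; ring.
Qed.

End products.

(** * The subgaussian bilinear form with its diagonal *)

Section hanson_wright.
Context {d} {T : measurableType d} {R : realType} (P : probability T R) {n : nat}.
Variable gen : 'I_n -> set (set T).
Hypothesis genm : forall i, gen i `<=` measurable.
Hypothesis ind : indep_sigma P (fun i => <<s gen i >>).

Lemma Eexp_bilinear_form (X Y : 'I_n -> T -> R) (b : R) (B : 'I_n -> 'I_n -> R) :
  (forall i, adapted (gen i) (X i)) -> (forall i, adapted (gen i) (Y i)) ->
  (forall i, subgaussian P (X i)) -> (forall i, subgaussian P (Y i)) ->
  0 < b -> 48 ^+ 4 * b <= 1 -> opbound B b ->
  (Eexp P (fun w => \sum_i \sum_j B i j * X i w * Y j w -
     \sum_j B j j * fine (\int[P]_w (X j w * Y j w)%:E)%E)%R <=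
   (expR (2^-1 * Cprod * \sum_j B j j ^+ 2 +
          36 * 48 ^+ 2 * \sum_i \sum_(j | i != j) B i j ^+ 2))%:E)%E.
Proof.
move=> aX aY sX sY b0 b1 hB.
have mX i : measurable_fun setT (X i) by apply: adapted_measurable (aX i).
have mY i : measurable_fun setT (Y i) by apply: adapted_measurable (aY i).
pose m j := fine (\int[P]_w (X j w * Y j w)%:E)%E; rewrite -/(m _).
have -> : (fun w => \sum_i \sum_j B i j * X i w * Y j w - \sum_j B j j * m j) =
   (fun w => \sum_j B j j * (X j w * Y j w - m j) +
      \sum_i \sum_(j | i != j) B i j * X i w * Y j w).
  apply/funext => w; rewrite sum_offdiag addrAC -sumrB; congr (_ + _).
  by apply: eq_bigr => j _; ring.
apply: EexpD_le.
- apply: measurable_sum_cond => i _; apply: measurable_funM => //.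
  by apply: measurable_funB => //; exact: measurable_funM.
- do 2!(apply: measurable_sum_cond => ? _).
  by do 2!apply: measurable_funM => //.
- have -> : 2 * (2^-1 * Cprod * \sum_j B j j ^+ 2) = \sum_j Cprod * B j j ^+ 2.
    by rewrite -mulr_sumr; field.
  under eq_fun do rewrite mulr_sumr.
  apply: (Eexp_sum_le genm ind (X := fun j w => 2 * (B j j * (X j w * Y j w - m j)))) => j.
    do 2!apply: measurable_funM => //.
    by apply: measurable_funB => //; apply: measurable_funM; [exact: aX|exact: aY].
  apply: Eexp_centered_product => //.
  have := opbound_entry j j b0 hB; rewrite -(real_normK (num_real (B j j))).
  have := normr_ge0 (B j j); nra.
- have -> : 2 * (36 * 48 ^+ 2 * \sum_i \sum_(j | i != j) B i j ^+ 2) =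
     72 * 48 ^+ 2 * \sum_i \sum_(j | i != j) B i j ^+ 2 by ring.
  exact: (Eexp_offdiag_form genm ind (b := b)).
Qed.

End hanson_wright.

(** * The operator norm as a maximal Rayleigh quotient *)

Section operator_norm.
Context {R : realType} {n : nat}.
Implicit Types (A M : 'M[R]_n) (v w : 'rV[R]_n).

(** Row vectors, because [eigenvalue] concerns the action v *m M. *)
Definition qform M v : R := (v *m M *m v^T) 0 0.

Lemma qformE M v : qform M v = \sum_i \sum_j v 0 i * M i j * v 0 j.
Proof.
rewrite /qform mxE exchange_big/=; apply: eq_bigr => j _.
by rewrite !mxE mulr_suml; apply: eq_bigr => i _.
Qed.

Lemma qform1 v : qform 1%:M v = \sum_j v 0 j ^+ 2.
Proof. by rewrite /qform mulmx1 mxE; apply: eq_bigr => j _; rewrite mxE expr2. Qed.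

Lemma qform1_eq0 v : qform 1%:M v = 0 -> v = 0.
Proof.
rewrite qform1 => /eqP; rewrite psumr_eq0; last by move=> j _; rewrite sqr_ge0.
move=> /allP v0; apply/rowP => j; rewrite mxE; apply/eqP.
by have := v0 j (mem_index_enum _); rewrite sqrf_eq0.
Qed.

Lemma qform_gram A v :
  qform (A^T *m A) v = \sum_i (\sum_j A i j * v 0 j) ^+ 2.
Proof.
rewrite /qform.
have -> : v *m (A^T *m A) *m v^T = (v *m A^T) *m (v *m A^T)^T.
  by rewrite trmx_mul trmxK !mulmxA.
rewrite mxE; apply: eq_bigr => i _; rewrite [X in _ * X]mxE -expr2; congr (_ ^+ 2).
by rewrite mxE; apply: eq_bigr => j _; rewrite mxE mulrC.
Qed.

Lemma qformZ M r v : qform M (r *: v) = r ^+ 2 * qform M v.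
Proof.
by rewrite /qform linearZ/= -scalemxAl -scalemxAr -!scalemxAl scalerA mxE expr2.
Qed.

Lemma continuous_qform M : continuous (qform M).
Proof.
have -> : qform M = (fun v => \sum_i \sum_j v 0 i * M i j * v 0 j).
  by apply/funext => v; exact: qformE.
do 2!(apply: continuous_big => [|? _]; first exact: add_continuous).
have cM (f g : 'rV[R]_n -> R) : continuous f -> continuous g -> continuous (f \* g).
  by move=> cf cg v; exact: (continuousM (cf v) (cg v)).
apply: (cM (fun v => v 0 _ * M _ _)); last exact: coord_continuous.
by apply: (cM (fun v => v 0 _)); [exact: coord_continuous|exact: cst_continuous].
Qed.

(* First-order optimality on the unit sphere: v is an eigenvector as soon as
   it maximizes the Rayleigh quotient. *)
Lemma rayleigh_eigen M v (l : R) : M^T = M ->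
  (forall w, qform M w <= l * qform 1%:M w) -> qform M v = l * qform 1%:M v ->
  v *m M = l *: v.
Proof.
move=> sM Ml Mv.
pose H := l%:M - M; have sH : H^T = H by rewrite /H linearB/= tr_scalar_mx sM.
have hE u : qform H u = l * qform 1%:M u - qform M u.
  by rewrite /qform /H mulmxBr mulmxBl mul_mx_scalar mulmx1 -scalemxAl !mxE.
have h0 u : 0 <= qform H u by rewrite hE subr_ge0.
have hv : qform H v = 0 by rewrite hE Mv subrr.
pose w := v *m H.
(* [H] is positive semidefinite and vanishes at [v]; moving from [v] against w = v H would make it
   negative to first order unless w = 0. *)
have e t : qform H (v - t *: w) = t ^+ 2 * qform H w - 2 * t * qform 1%:M w.
  have vHw : (v *m H *m w^T) 0 0 = qform 1%:M w by rewrite /qform mulmx1.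
  have wHv : (w *m H *m v^T) 0 0 = qform 1%:M w.
    by rewrite /qform mulmx1 -mulmxA {2}/w trmx_mul sH.
  have -> : qform H (v - t *: w) = qform H v - t * (w *m H *m v^T) 0 0 -
      t * ((v *m H *m w^T) 0 0 - t * qform H w).
    rewrite {1}/qform (_ : (v - t *: w)^T = v^T - t *: w^T); last first.
      by rewrite linearB/= linearZ.
    rewrite mulmxBl -scalemxAl mulmxBr -scalemxAr !mulmxBl -!scalemxAl /qform.
    move: (v *m H *m v^T) (w *m H *m v^T) (v *m H *m w^T) (w *m H *m w^T).
    by move=> a1 a2 a3 a4; rewrite !mxE.
  by rewrite hv vHw wHv; ring.
have w0 : qform 1%:M w = 0.
  have q0 := h0 w; have q1 : 0 < qform H w + 1 by lra.
  (* At t = N / (q + 1) the value is - t^2 (q + 2), so t = 0; the 1 keeps the denominator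
     positive. *)
  have := h0 (v - (qform 1%:M w / (qform H w + 1)) *: w); rewrite e.
  set N := qform 1%:M w; set q := qform H w in q0 q1 *.
  have -> : (N / (q + 1)) ^+ 2 * q - 2 * (N / (q + 1)) * N =
     - ((N / (q + 1)) ^+ 2 * (q + 2)) by field; rewrite gt_eqF.
  rewrite oppr_ge0 pmulr_lle0 ?ltr_wpDl// => N0.
  have /eqP : (N / (q + 1)) ^+ 2 = 0 by apply/eqP; rewrite eq_le N0 sqr_ge0.
  by rewrite sqrf_eq0 mulf_eq0 invr_eq0 (gt_eqF q1) orbF => /eqP.
have : w = 0 by exact: qform1_eq0.
by rewrite /w /H mulmxBr mul_mx_scalar => /eqP; rewrite subr_eq0 => /eqP ->.
Qed.

(** The Rayleigh quotient attains its maximum [l] on the compact unit sphere. [l] is an eigenvalue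
    and bounds all others, so the set under [sup] in [opnorm2] is nonempty and bounded; positivity
    of [n] makes the sphere nonempty. *)
Lemma sum_sqr_mulmx_le A (x : 'I_n -> R) : (0 < n)%N ->
  \sum_i (\sum_j A i j * x j) ^+ 2 <= opnorm2 A ^+ 2 * \sum_j x j ^+ 2.
Proof.
move=> n0; pose M := A^T *m A.
have sM : M^T = M by rewrite /M trmx_mul trmxK.
have M0 v : 0 <= qform M v.
  by rewrite qform_gram sumr_ge0// => i _; rewrite sqr_ge0.
pose S := [set v : 'rV[R]_n | qform 1%:M v = 1].
have cS : compact S.
  apply: (@subclosed_compact _ _
      [set v : 'rV[R]_n | forall i, v ord0 i \in `[-1, 1]]).
  - rewrite (_ : S = qform 1%:M @^-1` [set 1]); last by [].
    apply: closed_comp; first by move=> v _; exact: continuous_qform.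
    exact: closed_eq.
  - apply: (@rV_compact R n (fun=> `[-1, 1]%classic)).
    by move=> _; exact: segment_compact.
  - move=> v; rewrite /S/= qform1 => v1 i.
    rewrite in_itv/= -ler_norml -(@ler_pXn2r _ 2) ?nnegrE// expr1n.
    rewrite real_normK ?num_real// -v1 (bigD1 i)//= lerDl sumr_ge0// => j _.
    by rewrite sqr_ge0.
have S0 : S !=set0.
  exists (delta_mx 0 (Ordinal n0)); rewrite /S/= qform1 (bigD1 (Ordinal n0))//=.
  rewrite mxE !eqxx expr1n big1 ?addr0// => j jn.
  by rewrite mxE (negbTE jn) andbF expr0n.
have [v] := EVT_max_rV S0 cS (continuous_subspaceT (@continuous_qform M)).
rewrite inE /S/= => v1 vmax.
set l := qform M v.
have Ml w : qform M w <= l * qform 1%:M w.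
  have [w0|w0] := eqVneq (qform 1%:M w) 0.
    rewrite (qform1_eq0 w0).
    by rewrite -(scale0r (0 : 'rV[R]_n)) !qformZ expr0n/= !mul0r mulr0.
  have {}w0 : 0 < qform 1%:M w.
    by rewrite lt_def w0 qform1 sumr_ge0// => j _; rewrite sqr_ge0.
  pose r := (Num.sqrt (qform 1%:M w))^-1.
  have r2 : r ^+ 2 = (qform 1%:M w)^-1 by rewrite exprVn sqr_sqrtr// ltW.
  have : qform M (r *: w) <= l.
    by apply: vmax; rewrite inE /S/= qformZ r2 mulVf// gt_eqF.
  by rewrite qformZ r2 ler_pdivrMl// mulrC.
have ev := rayleigh_eigen sM Ml (esym (etrans (congr1 _ v1) (mulr1 l))).
have El : eigenvalue M l.
  apply/eigenvalueP; exists v => //.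
  apply: contra_eq_neq v1 => ->.
  by rewrite -(scale0r (0 : 'rV[R]_n)) qformZ expr0n/= mul0r eq_sym oner_eq0.
have ubl : ubound [set a | eigenvalue M a] l.
  move=> a /= /eigenvalueP[u uM u0].
  have : qform M u = a * qform 1%:M u.
    by rewrite /qform uM mulmx1 -scalemxAl mxE.
  have u1 : 0 < qform 1%:M u.
    rewrite qform1 lt_def sumr_ge0 ?andbT; last by move=> j _; rewrite sqr_ge0.
    by apply: contra u0 => /eqP u00; apply/eqP/qform1_eq0; rewrite qform1.
  by move=> e; have := Ml u; rewrite e ler_pM2r.
have hs : has_sup [set a | eigenvalue M a] by split; exists l.
have ls : l <= sup [set a | eigenvalue M a] by apply: sup_upper_bound.
have xE i : \sum_j A i j * x j = \sum_j A i j * (\row_j x j) 0 j.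
  by apply: eq_bigr => j _; rewrite mxE.
under eq_bigr => i _ do rewrite xE.
rewrite -qform_gram; apply: le_trans (Ml _) _; rewrite qform1.
rewrite /opnorm2 sqr_sqrtr; last exact: (le_trans (M0 v) ls).
under [X in l * X]eq_bigr => j _ do rewrite mxE.
by rewrite ler_wpM2r// sumr_ge0// => j _; rewrite sqr_ge0.
Qed.

End operator_norm.

(** * Bilinear forms of Bernoulli variables *)

Section bernoulli.
Context {d} {T : measurableType d} {R : realType} (P : probability T R).
Implicit Types g : T -> R.

Definition bernoulli_rv g (p : R) :=
  [/\ measurable_fun setT g, forall w, g w = 0 \/ g w = 1 &
      (\int[P]_w (g w)%:E)%E = p%:E].

Lemma bernoulli_rv01 g p w : bernoulli_rv g p -> 0 <= g w <= 1.
Proof. by move=> [_ /(_ w)[->|->] _]; rewrite lexx ler01. Qed.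

Lemma bernoulli_rv_prob g p : bernoulli_rv g p -> 0 <= p <= 1.
Proof.
move=> gp; have [mg g01 gE] := gp; apply/andP; split.
  rewrite -lee_fin -gE; apply: integral_ge0 => w _; rewrite lee_fin.
  by have /andP[] := bernoulli_rv01 w gp.
rewrite -lee_fin -gE; apply: (@le_trans _ _ (\int[P]_w 1%E)%E).
  apply: ge0_le_integral => //.
  - by move=> w _; rewrite lee_fin; have /andP[] := bernoulli_rv01 w gp.
  - exact/measurable_EFinP.
  - by move=> w _; rewrite lee_fin; have /andP[] := bernoulli_rv01 w gp.
have := integral_cst P measurableT 1%E.
by rewrite /= probability_setT mule1 => ->.
Qed.

Lemma bernoulli_rvM g h p q r : bernoulli_rv g p -> bernoulli_rv h q ->
  (\int[P]_w (g w * h w)%:E)%E = r%:E -> bernoulli_rv (fun w => g w * h w) r.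
Proof.
move=> [mg g01 _] [mh h01 _] ghr; split => //; first exact: measurable_funM.
by move=> w; have [->|->] := g01 w; have [->|->] := h01 w;
  rewrite ?mul0r ?mulr0 ?mulr1; [left|left|left|right].
Qed.

(** 1 + p (e^y - 1) <= 1 + p z <= e^(p z). Negative [y] is needed: diagonal coefficients have both
    signs. *)
Lemma Eexp_bernoulli g (p y : R) : bernoulli_rv g p -> y <= 2^-1 ->
  (Eexp P (fun w => g w * y)%R <= (expR (p * (y + 2 * y ^+ 2)))%:E)%E.
Proof.
move=> gp y2; have [mg g01 gE] := gp; have /andP[p0 p1] := bernoulli_rv_prob gp.
set z := y + 2 * y ^+ 2.
(* Complete the square; this keeps [1 + p * z] nonnegative, as [Eexp_le_centered] demands. *)
have z8 : - 8^-1 <= z by rewrite /z; have := sqr_ge0 (y + 4^-1); lra.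
have ig : P.-integrable setT (EFin \o g).
  apply: (le_integrable measurableT _ _ (finite_measure_integrable_cst P 1 measurableT)).
    exact/measurable_EFinP.
  move=> w _ /=; rewrite lee_fin normr1; have /andP[g0 g1] := bernoulli_rv01 w gp.
  by rewrite ger0_norm.
have iV : P.-integrable setT (EFin \o (fun w => (g w - p) * z)).
  have := integrableZl measurableT z (integrableB measurableT
    ig (finite_measure_integrable_cst P p measurableT)).
  congr (P.-integrable setT _); apply/funext => w /=.
  by rewrite -EFinB -EFinM mulrC.
apply: (@le_trans _ _ (\int[P]_w (1 + p * z)%:E)%E).
  apply: (Eexp_le_centered iV) => //.
  - have -> : (fun w => ((g w - p) * z)%:E) = (fun w => z%:E * ((g w)%:E - p%:E))%E.
      by apply/funext => w; rewrite -EFinB -EFinM mulrC.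
    rewrite integralZl//; last first.
      by apply: integrableB => //; exact: finite_measure_integrable_cst.
    rewrite integralB//; last exact: finite_measure_integrable_cst.
    rewrite gE; have := integral_cst P measurableT p%:E.
    by rewrite /= probability_setT mule1 => ->; rewrite subee// mule0.
  - exact: measurable_funM.
  - by move=> w; nra.
  - move=> w; rewrite [leRHS](_ : _ = 1 + g w * z); last by ring.
    have [->|->] := g01 w; first by rewrite !mul0r expR0 addr0.
    by rewrite !mul1r /z addrA; exact: expR_le_1D2sqr.
have := integral_cst P measurableT (1 + p * z)%:E.
rewrite /= probability_setT mule1 => ->; rewrite lee_fin; exact: expR_ge1Dx.
Qed.

Lemma Eexp_bernoulli_small g (p y : R) : bernoulli_rv g p -> 0 <= y <= 2^-1 ->
  (Eexp P (fun w => g w * y)%R <= (expR (2 * p * y))%:E)%E.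
Proof.
move=> gp /andP[y0 y2]; apply: (le_trans (Eexp_bernoulli gp y2)).
rewrite lee_fin ler_expR; have /andP[p0 _] := bernoulli_rv_prob gp.
by rewrite [2 * p]mulrC -mulrA ler_wpM2l//; nra.
Qed.

End bernoulli.

Section bernoulli_forms.
Context {d} {T : measurableType d} {R : realType} (P : probability T R) {n : nat}.
Variable gen : 'I_n -> set (set T).
Hypothesis genm : forall i, gen i `<=` measurable.
Hypothesis ind : indep_sigma P (fun i => <<s gen i >>).

(** Decoupling costs 4, integrating out [h] costs 2 and integrating out [g] another 2, hence 16. The
    row and column conditions keep every exponent within the range of [Eexp_bernoulli_small]. *)
Lemma Eexp_bernoulli_offdiag (g h : 'I_n -> T -> R) (p q : 'I_n -> R)
    (c : 'I_n -> 'I_n -> R) :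
  (forall i, adapted (gen i) (g i)) -> (forall i, adapted (gen i) (h i)) ->
  (forall i, bernoulli_rv P (g i) (p i)) -> (forall i, bernoulli_rv P (h i) (q i)) ->
  (forall i j, 0 <= c i j) ->
  (forall i, 8 * \sum_j c i j <= 2^-1) -> (forall j, 8 * \sum_i c i j <= 2^-1) ->
  (Eexp P (fun w => \sum_i \sum_(j | i != j) c i j * g i w * h j w)%R <=
   (expR (16 * \sum_i \sum_(j | i != j) c i j * p i * q j))%:E)%E.
Proof.
move=> ag ah gp hq c0 cr cc.
have g01 i w := bernoulli_rv01 w (gp i).
have p01 i := bernoulli_rv_prob (gp i); have q01 i := bernoulli_rv_prob (hq i).
have mg i : measurable_fun setT (g i) by have [] := gp i.
have mh i : measurable_fun setT (h i) by have [] := hq i.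
apply: (@Eexp_decoupling _ _ _ P n (fun i j w => c i j * g i w * h j w)).
  by move=> i j; do 2!apply: measurable_funM => //.
move=> L.
pose u j w := 4 * \sum_(i in L) c i j * g i w.
pose s := [seq j <- index_enum 'I_n | j \notin L].
have := @Eexp_chain _ _ _ P _ gen genm ind s (mem L) h u (cst 0)
  (fun j => fun r => 2 * q j * r) [set r | 0 <= r <= 2^-1].
have -> : (fun w => \sum_(j <- s) h j w * u j w + cst 0 w) =
    (fun w => 4 * \sum_(i in L) \sum_(j | j \notin L) c i j * g i w * h j w).
  apply/funext => w; rewrite addr0 /s big_filter exchange_big/= mulr_sumr.
  apply: eq_bigr => j _; rewrite /u mulrCA; congr (_ * _).
  by rewrite mulr_sumr; apply: eq_bigr => i _; ring.
pose v i := if i \in L then 8 * \sum_(j | j \notin L) c i j * q j else 0.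
have -> : (fun w => \sum_(j <- s) 2 * q j * u j w + cst 0 w) =
    (fun w => \sum_i g i w * v i).
  apply/funext => w; rewrite addr0 /s big_filter.
  under eq_bigr => j _ do rewrite /u mulrA mulr_sumr.
  rewrite exchange_big/= big_mkcond/=; apply: eq_bigr => i _; rewrite /v.
  case: ifP => _; last by rewrite mulr0.
  by rewrite mulrA mulr_sumr; apply: eq_bigr => j _; ring.
move=> chain; apply: le_trans (chain _ _ _ _ _ _ _ _) _.
- by rewrite filter_uniq// index_enum_uniq.
- by move=> j; rewrite mem_filter => /andP[].
- exact: ah.
- move=> j; apply: measurable_funM => //; apply: measurable_sum_cond => i iL.
  by apply: measurable_funM => //; apply: adapted_sub (ag i); exact: gen_sub_gens.
- exact: measurable_cst.
- by move=> j; exact: measurable_funM.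
- move=> j w /=; rewrite /u; apply/andP; split.
    rewrite mulr_ge0// sumr_ge0// => i _; rewrite mulr_ge0//.
    by have /andP[] := g01 i w.
  have : \sum_(i in L) c i j * g i w <= \sum_i c i j.
    rewrite big_mkcond/=; apply: ler_sum => i _; case: ifP => // _.
    by rewrite ler_piMr//; have /andP[] := g01 i w.
  have : 0 <= \sum_i c i j by rewrite sumr_ge0.
  have := cc j; lra.
- by move=> j r; exact: Eexp_bernoulli_small.
have v01 i : 0 <= v i <= 2^-1.
  rewrite /v; case: ifP => _; last by apply/andP; split; lra.
  apply/andP; split.
    rewrite mulr_ge0// sumr_ge0// => j _; rewrite mulr_ge0//.
    by have /andP[] := q01 j.
  apply: le_trans (cr i); rewrite ler_wpM2l// big_mkcond/=.
  apply: ler_sum => j _; case: ifP => // _.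
  by rewrite ler_piMr//; have /andP[] := q01 j.
apply: (le_trans (Eexp_sum_le genm ind (X := fun i w => g i w * v i)
  (c := fun i => 2 * p i * v i) _ _)).
- by move=> i; apply: measurable_funM => //; exact: ag.
- by move=> i; exact: Eexp_bernoulli_small.
rewrite lee_fin ler_expR mulr_sumr; apply: ler_sum => i _.
have /andP[pi0 _] := p01 i.
have t0 j : 0 <= c i j * p i * q j.
  by rewrite mulr_ge0 ?mulr_ge0//; have /andP[] := q01 j.
rewrite /v; case: ifPn => iL; last by rewrite mulr0 mulr_ge0// sumr_ge0.
have -> : 2 * p i * (8 * \sum_(j | j \notin L) c i j * q j) =
    16 * \sum_(j | j \notin L) c i j * p i * q j.
  by rewrite !mulr_sumr; apply: eq_bigr => j _; ring.
rewrite ler_wpM2l// big_mkcond/= [leRHS]big_mkcond/=; apply: ler_sum => j _.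
case: ifPn => [jL|_]; last by case: ifP.
by case: eqVneq jL => [<-|//]; rewrite iL.
Qed.

End bernoulli_forms.

(** * Numerical constants *)

Section constants.
Context {R : realType}.

Definition Coff : R := 36 * 48 ^+ 2.

(** [Cprod] comes from the conditional variance term, the rest from 2 y^2 in the Bernoulli bound,
    where |y| <= (2 [Cmean] + 1) |a_jj|. *)
Definition Cdiag : R := Cprod + 2 * (2 * Cmean + 1) ^+ 2.

Definition Chw : R := 2^-1 * Cdiag + 16 * Coff.

(* On opbound a (hw_radius ^+ 2) all the exponents met below are small enough
   for the second-order bounds on the exponential to apply. *)
Definition hw_radius : R :=
  (48 ^+ 2 + Cprod + 2 * (2 * Cmean + 1) + 32 * Coff)^-1.

Lemma Cmean_gt0 : 0 < Cmean :> R.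
Proof. by rewrite mulr_gt0 ?expR_gt0. Qed.

Lemma Cprod_gt0 : 0 < Cprod :> R.
Proof. by rewrite mulr_gt0 ?expR_gt0// mulr_gt0 ?expR_gt0// mulr_gt0// exprn_gt0. Qed.

Lemma Coff_gt0 : 0 < Coff.
Proof. by rewrite mulr_gt0// exprn_gt0. Qed.

Lemma Cdiag_gt0 : 0 < Cdiag.
Proof. by rewrite ltr_pwDl ?Cprod_gt0// mulr_ge0// sqr_ge0. Qed.

Lemma Chw_gt0 : 0 < Chw.
Proof. by rewrite addr_gt0// mulr_gt0// ?Cdiag_gt0 ?Coff_gt0// invr_gt0. Qed.

Let S_gt0 : 0 < 48 ^+ 2 + Cprod + 2 * (2 * Cmean + 1) + 32 * Coff.
Proof.
have := Cmean_gt0; have := Cprod_gt0; have := Coff_gt0.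
have : 0 < 48 ^+ 2 :> R by rewrite exprn_gt0.
lra.
Qed.

Lemma hw_radius_gt0 : 0 < hw_radius.
Proof. by rewrite invr_gt0. Qed.

(** In order: the condition 48^4 b <= 1, the absorption of [Cprod] a^2 into |a|, diagonal Bernoulli
    exponents below 1/2, and the row and column sums off the diagonal. *)
Lemma hw_radius_le : [/\ 48 ^+ 2 * hw_radius <= 1, Cprod * hw_radius <= 1,
  2 * (2 * Cmean + 1) * hw_radius <= 1 & 32 * Coff * hw_radius <= 1].
Proof.
have := Cmean_gt0; have := Cprod_gt0; have := Coff_gt0.
have : 0 < 48 ^+ 2 :> R by rewrite exprn_gt0.
by split; rewrite ler_pdivrMr//; lra.
Qed.

Lemma hw_radius_le1 : hw_radius <= 1.
Proof.
have [h _ _ _] := hw_radius_le; apply: le_trans h.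
by rewrite ler_peMl ?(ltW hw_radius_gt0)// exprn_ege1// ler1n.
Qed.

End constants.

(** * Joining the subgaussian and the Bernoulli families *)

Section sparse_bilinear.
Context {d} {T : measurableType d} {R : realType} (P : probability T R) {n : nat}.
Variables genZ genG : 'I_n -> set (set T).
Hypothesis genZm : forall i, genZ i `<=` measurable.
Hypothesis genGm : forall i, genG i `<=` measurable.
Hypothesis indZ : indep_sigma P (fun i => <<s genZ i >>).
Hypothesis indG : indep_sigma P (fun i => <<s genG i >>).
Variables GZ GG : set (set T).
Hypotheses (GZm : GZ `<=` measurable) (GGm : GG `<=` measurable).
Hypothesis indZG : forall A B, <<s GZ >> A -> <<s GG >> B ->
  P (A `&` B) = (P A * P B)%E.
Variables X Y g h : 'I_n -> T -> R.
Hypotheses (aX : forall i, adapted (genZ i) (X i))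
           (aY : forall i, adapted (genZ i) (Y i))
           (ag : forall i, adapted (genG i) (g i))
           (ah : forall i, adapted (genG i) (h i)).
Hypotheses (aX' : forall i, adapted GZ (X i)) (aY' : forall i, adapted GZ (Y i))
           (ag' : forall i, adapted GG (g i)) (ah' : forall i, adapted GG (h i)).
Hypotheses (sX : forall i, subgaussian P (X i)) (sY : forall i, subgaussian P (Y i)).
Variables p q r : 'I_n -> R.
Hypotheses (gp : forall i, bernoulli_rv P (g i) (p i))
           (hq : forall i, bernoulli_rv P (h i) (q i))
           (ghr : forall i, bernoulli_rv P (fun w => g i w * h i w) (r i)).

Let m j := fine (\int[P]_w (X j w * Y j w)%:E)%E.

Let mg i : measurable_fun setT (g i). Proof. by have [] := gp i. Qed.
Let mh i : measurable_fun setT (h i). Proof. by have [] := hq i. Qed.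
Let mX i : measurable_fun setT (X i). Proof. exact: (adapted_measurable (@genZm i) (@aX i)). Qed.
Let mY i : measurable_fun setT (Y i). Proof. exact: (adapted_measurable (@genZm i) (@aY i)). Qed.

Let g2 i w : g i w ^+ 2 = g i w.
Proof. by have [_ /(_ w)[->|->] _] := gp i; rewrite ?expr0n ?expr1n. Qed.

Let h2 i w : h i w ^+ 2 = h i w.
Proof. by have [_ /(_ w)[->|->] _] := hq i; rewrite ?expr0n ?expr1n. Qed.

Definition sparse_form (a : 'I_n -> 'I_n -> R) w :=
  \sum_i \sum_j a i j * (X i w * g i w) * (Y j w * h j w).

Definition sparse_mean (a : 'I_n -> 'I_n -> R) := \sum_j a j j * r j * m j.

Definition sparse_frob2 (a : 'I_n -> 'I_n -> R) :=
  \sum_j r j * a j j ^+ 2 + \sum_i \sum_(j | i != j) a i j ^+ 2 * p i * q j.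

(** The exponent of [Eexp_bilinear_form] for the matrix masked by frozen [g i] and [h j], simplified
    by g^2 = g and h^2 = h, and recentred from the conditional mean to [sparse_mean]. *)
Let cond_exponent (a : 'I_n -> 'I_n -> R) w :=
  \sum_j (g j w * h j w * (a j j * m j + 2^-1 * Cprod * a j j ^+ 2) -
          a j j * r j * m j) +
  \sum_i \sum_(j | i != j) Coff * a i j ^+ 2 * g i w * h j w.

Let Eexp_sparse_cond (a : 'I_n -> 'I_n -> R) (b : R) : 0 < b -> 48 ^+ 4 * b <= 1 ->
  opbound a b ->
  (Eexp P (fun w => sparse_form a w - sparse_mean a)%R <= Eexp P (cond_exponent a))%E.
Proof.
move=> b0 b1 ha.
pose F (x : g_sigma_algebraType GZ * g_sigma_algebraType GG) :=
  (expR (\sum_i \sum_j a i j * (X i x.1 * g i x.2) * (Y j x.1 * h j x.2)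
     - sparse_mean a))%:E.
have mF : measurable_fun
    [set: (g_sigma_algebraType GZ * g_sigma_algebraType GG)%type] F.
  apply/measurable_EFinP; apply: measurableT_comp => //.
  apply: measurable_funB => //; do 2!(apply: measurable_sum_cond => ? _).
  apply: measurable_funM; [apply: measurable_funM => //|]; apply: measurable_funM.
  - exact: (measurableT_comp (@aX' _)).
  - exact: (measurableT_comp (@ag' _)).
  - exact: (measurableT_comp (@aY' _)).
  - exact: (measurableT_comp (@ah' _)).
have F0 x : (0 <= F x)%E by rewrite lee_fin expR_ge0.
rewrite {1}/Eexp (fubini_indep GZm GGm indZG mF F0).
apply: ge0_le_integral => //.
- by move=> w _; exact: integral_ge0.
- exact: (measurable_fubini_indep P GZm GGm mF F0).
- apply: measurable_EexpR; apply: measurable_funD.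
    apply: measurable_sum_cond => i _; apply: measurable_funB => //.
    by apply: measurable_funM => //; exact: measurable_funM.
  do 2!(apply: measurable_sum_cond => ? _).
  by do 2!apply: measurable_funM => //.
- move=> w _; rewrite /F/=.
  pose B i j := g i w * h j w * a i j.
  have hB : opbound B b.
    apply: opbound_mask => //; first exact: ltW.
    + by move=> i; rewrite g2; have /andP[] := bernoulli_rv01 w (gp i).
    + by move=> i; rewrite h2; have /andP[] := bernoulli_rv01 w (hq i).
  have := Eexp_bilinear_form genZm indZ aX aY sX sY b0 b1 hB.
  have mB : measurable_fun setT (fun v => \sum_i \sum_j B i j * X i v * Y j v -
      \sum_j B j j * fine (\int[P]_u (X j u * Y j u)%:E)%E).
    apply: measurable_funB => //; do 2!(apply: measurable_sum_cond => ? _).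
    by apply: measurable_funM => //; exact: measurable_funM.
  move=> /(EexpD_cst_le (\sum_j B j j * m j - sparse_mean a) mB).
  set f := (fun _ => _ + _); set s := (_ + _ + _).
  have -> : f = (fun v => \sum_i \sum_j a i j * (X i v * g i w) * (Y j v * h j w)
     - sparse_mean a).
    apply/funext => v; rewrite /f addrA subrK; congr (_ - _).
    by apply: eq_bigr => i _; apply: eq_bigr => j _; rewrite /B; ring.
  suff -> : s = cond_exponent a w by [].
  rewrite /s; rewrite /cond_exponent /sparse_mean sumrB.
  have -> : \sum_j g j w * h j w * (a j j * m j + 2^-1 * Cprod * a j j ^+ 2) =
      2^-1 * Cprod * \sum_j B j j ^+ 2 + \sum_j B j j * m j.
    rewrite mulr_sumr -big_split/=; apply: eq_bigr => j _.
    have -> : B j j ^+ 2 = g j w * h j w * a j j ^+ 2 by rewrite /B !exprMn g2 h2.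
    by rewrite /B; ring.
  have -> : \sum_i \sum_(j | i != j) Coff * a i j ^+ 2 * g i w * h j w =
      36 * 48 ^+ 2 * \sum_i \sum_(j | i != j) B i j ^+ 2.
    rewrite mulr_sumr; apply: eq_bigr => i _; rewrite mulr_sumr.
    apply: eq_bigr => j _; rewrite -/Coff.
    have -> : B i j ^+ 2 = g i w * h j w * a i j ^+ 2 by rewrite /B !exprMn g2 h2.
    by ring.
  by ring.
Qed.

Lemma Eexp_sparse_form (a : 'I_n -> 'I_n -> R) : opbound a (hw_radius ^+ 2) ->
  (Eexp P (fun w => sparse_form a w - sparse_mean a)%R <=
   (expR (Chw * sparse_frob2 a))%:E)%E.
Proof.
move=> ha; set b := hw_radius in ha.
have b0 : 0 < b by exact: hw_radius_gt0.
have b1 : b <= 1 by exact: hw_radius_le1.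
have [c1 c2 c3 c4] := @hw_radius_le R; rewrite -/b in c1 c2 c3 c4.
have bb0 : 0 < b ^+ 2 by rewrite exprn_gt0.
have bb1 : b ^+ 2 <= b by rewrite expr2 ler_piMr// ltW.
have Coff0 := @Coff_gt0 R; have Cprod0 := @Cprod_gt0 R.
have Cmean0 := @Cmean_gt0 R; have Cdiag0 := @Cdiag_gt0 R.
apply: (le_trans (Eexp_sparse_cond bb0 _ ha)).
  rewrite (_ : 48 ^+ 4 * b ^+ 2 = (48 ^+ 2 * b) ^+ 2); last by rewrite exprMn -exprM.
  by rewrite expr_le1// mulr_ge0// ltW.
have diag j : `|a j j| <= b.
  rewrite -(@ler_pXn2r _ 2) ?nnegrE ?(ltW b0)// real_normK ?num_real//.
  exact: opbound_entry ha.
rewrite /cond_exponent /Chw /sparse_frob2.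
have t0 i j : 0 <= a i j ^+ 2 * p i * q j.
  have /andP[p0 _] := bernoulli_rv_prob (gp i).
  have /andP[q0 _] := bernoulli_rv_prob (hq j).
  by apply: mulr_ge0 => //; apply: mulr_ge0 => //; exact: sqr_ge0.
have r0 j : 0 <= r j by have /andP[] := bernoulli_rv_prob (ghr j).
apply: (@le_trans _ _ (expR (2^-1 * Cdiag * (\sum_j r j * a j j ^+ 2) +
    16 * Coff * \sum_i \sum_(j | i != j) a i j ^+ 2 * p i * q j))%:E); last first.
  rewrite lee_fin ler_expR; set S1 := \sum_j r j * _;
    set S2 := \sum_i _.
  have S10 : 0 <= S1 by apply: sumr_ge0 => j _; rewrite mulr_ge0// sqr_ge0.
  have S20 : 0 <= S2 by apply: sumr_ge0 => i _; apply: sumr_ge0.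
  have := mulr_ge0 (ltW Cdiag0) S20; have := mulr_ge0 (ltW Coff0) S10.
  by move: Cdiag Coff => D C; lra.
apply: EexpD_le.
- apply: measurable_sum_cond => i _; apply: measurable_funB => //.
  by apply: measurable_funM => //; exact: measurable_funM.
- do 2!(apply: measurable_sum_cond => ? _).
  by do 2!apply: measurable_funM => //.
(* The total coefficient of [g j w * h j w] in the doubled diagonal exponent. *)
- pose y j := 2 * a j j * m j + Cprod * a j j ^+ 2.
  have -> : (fun w => 2 * \sum_j (g j w * h j w * (a j j * m j +
        2^-1 * Cprod * a j j ^+ 2) - a j j * r j * m j)) =
      (fun w => \sum_j (g j w * h j w * y j - 2 * (a j j * r j * m j))).
    apply/funext => w; rewrite mulr_sumr; apply: eq_bigr => j _.
    by rewrite /y; field.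
  have -> : 2 * (2^-1 * Cdiag * (\sum_j r j * a j j ^+ 2)) =
      \sum_j r j * (Cdiag * a j j ^+ 2).
    by rewrite !mulr_sumr; apply: eq_bigr => j _; field.
  apply: (Eexp_sum_le genGm indG
    (X := fun j w => g j w * h j w * y j - 2 * (a j j * r j * m j))) => j.
    apply: measurable_funB => //; apply: measurable_funM => //.
    by apply: measurable_funM; [exact: ag|exact: ah].
  have mm : `|m j| <= Cmean by exact: norm_mean_product.
  have ya : `|y j| <= (2 * Cmean + 1) * `|a j j|.
    have h1 : `|2 * a j j * m j| <= 2 * Cmean * `|a j j|.
      by rewrite !normrM ger0_norm// mulrAC ler_wpM2r// ler_wpM2l.
    have h2' : `|Cprod * a j j ^+ 2| <= `|a j j|.
      rewrite normrM (gtr0_norm Cprod0) expr2 normrM mulrA ler_piMl//.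
      by apply: le_trans c2; rewrite ler_wpM2l// ltW.
    by rewrite [leRHS]mulrDl mul1r; exact: le_trans (ler_normD _ _) (lerD h1 h2').
  have y2 : y j <= 2^-1.
    apply: (le_trans (ler_norm _)); apply: (le_trans ya).
    apply: (@le_trans _ _ ((2 * Cmean + 1) * b)); last lra.
    by rewrite ler_wpM2l// addr_ge0// mulr_ge0// ltW.
  have mgh : measurable_fun setT (fun w => g j w * h j w * y j).
    by apply: measurable_funM => //; exact: measurable_funM.
  apply: (le_trans (EexpD_cst_le _ mgh (Eexp_bernoulli (ghr j) y2))).
  rewrite lee_fin ler_expR.
  (* The terms linear in a_jj cancel here: 2 a_jj m_j r_j from [y j] against the doubled
     centering. *)
  rewrite [leLHS](_ : _ = r j * (Cprod * a j j ^+ 2 + 2 * y j ^+ 2)); last first.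
    by rewrite /y; ring.
  have y2a : y j ^+ 2 <= (2 * Cmean + 1) ^+ 2 * a j j ^+ 2.
    rewrite -exprMn -(real_normK (num_real (y j))).
    rewrite -(real_normK (num_real ((2 * Cmean + 1) * a j j))).
    rewrite lerXn2r ?nnegrE// normrM [`|2 * _ + 1|]ger0_norm//.
    by rewrite addr_ge0// mulr_ge0// ltW.
  rewrite ler_wpM2l//.
  have -> : Cdiag * a j j ^+ 2 =
      Cprod * a j j ^+ 2 + 2 * ((2 * Cmean + 1) ^+ 2 * a j j ^+ 2).
    by rewrite /Cdiag; ring.
  by rewrite lerD2l ler_wpM2l.
- have small_sum (S : R) : S <= b -> 8 * (2 * Coff * S) <= 2^-1.
    move=> Sb; have := ler_wpM2l (ltW Coff0) Sb.
    by move: Coff c4 => C; lra.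
  pose c i j := 2 * Coff * a i j ^+ 2.
  have -> : (fun w => 2 * \sum_i \sum_(j | i != j) Coff * a i j ^+ 2 * g i w * h j w) =
      (fun w => \sum_i \sum_(j | i != j) c i j * g i w * h j w).
    apply/funext => w; rewrite mulr_sumr; apply: eq_bigr => i _.
    by rewrite mulr_sumr; apply: eq_bigr => j _; rewrite /c !mulrA.
  have -> : 2 * (16 * Coff * \sum_i \sum_(j | i != j) a i j ^+ 2 * p i * q j) =
      16 * \sum_i \sum_(j | i != j) c i j * p i * q j.
    rewrite !mulr_sumr; apply: eq_bigr => i _.
    by rewrite !mulr_sumr; apply: eq_bigr => j _; rewrite /c; ring.
  apply: (Eexp_bernoulli_offdiag genGm indG) => //.
  + move=> i j; apply: mulr_ge0; last exact: sqr_ge0.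
    by rewrite mulr_ge0// ltW.
  + move=> i; rewrite -mulr_sumr; apply: small_sum.
    exact: le_trans (opbound_row i bb0 ha) bb1.
  + move=> j; rewrite -mulr_sumr; apply: small_sum.
    exact: le_trans (opbound_row j bb0 (opbound_tr bb0 ha)) bb1.
Qed.

End sparse_bilinear.

(** * From exponential moments to tails *)

Lemma measurable_ltr_fun {d} {T : measurableType d} {R : realType} (f : T -> R) (s : R) :
  measurable_fun setT f -> measurable [set w | s < f w].
Proof.
move=> mf; rewrite (_ : [set w | _] = setT `&` f @^-1` `]s, +oo[%classic); last first.
  by rewrite setTI; apply/seteqP; split => w /=; rewrite in_itv/= andbT.
exact: mf.
Qed.

Lemma markov_Eexp {d} {T : measurableType d} {R : realType} (P : probability T R)
    (W : T -> R) (s e : R) : measurable_fun setT W ->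
  (Eexp P W <= (expR e)%:E)%E ->
  (P [set w | (s < W w)%R] <= (expR (e - s))%:E)%E.
Proof.
move=> mW We; set A := [set w | _].
have mA : measurable A by exact: measurable_ltr_fun.
have : ((expR s)%:E * P A <= (expR e)%:E)%E.
  apply: le_trans We.
  have -> : P A = (\int[P]_w (\1_A w)%:E)%E by rewrite integral_indic// setIT.
  rewrite -ge0_integralZl//; last first.
  - by apply/measurable_EFinP; exact: measurable_indic.
  apply: ge0_le_integral => //.
  - by apply: measurable_funeM; apply/measurable_EFinP; exact: measurable_indic.
  - exact: measurable_EexpR.
  - move=> w _; rewrite -EFinM lee_fin indicE.
    have [|_] := boolP (w \in A); last by rewrite mulr0 expR_ge0.
    by rewrite inE /A/= mulr1 ler_expR => /ltW.
rewrite -(fineK (fin_num_measure P _ mA)) -EFinM !lee_fin => h.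
by rewrite expRD expRN [leRHS]mulrC ler_pdivlMl ?expR_gt0.
Qed.

Section tails.
Context {d} {T : measurableType d} {R : realType} (P : probability T R).
Variables (W : T -> R) (mW : measurable_fun setT W).
Variables (dl C : R).
Hypotheses (dl0 : 0 < dl) (C0 : 0 < C).
Hypothesis mgf : forall x : R, `|x| <= dl ->
  (Eexp P (fun w => x * W w)%R <= (expR (C * x ^+ 2))%:E)%E.

Let mxW x : measurable_fun setT (fun w => x * W w).
Proof. exact: measurable_funM. Qed.

Let integrable_expR (x : R) : `|x| <= dl ->
  P.-integrable setT (fun w => (expR (x * W w))%:E).
Proof.
move=> xdl; apply/integrableP; split; first exact: measurable_EexpR.
under eq_integral do rewrite abse_EFin ger0_norm ?expR_ge0//.
exact: le_lt_trans (mgf xdl) (ltry _).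
Qed.

Lemma integrable_of_Eexp : P.-integrable setT (EFin \o W).
Proof.
have h1 : `|dl| <= dl by rewrite gtr0_norm.
have h2 : `|- dl| <= dl by rewrite normrN gtr0_norm.
have := integrableZl measurableT dl^-1
  (integrableD measurableT (integrable_expR h1) (integrable_expR h2)).
apply: le_integrable => //; first exact/measurable_EFinP.
move=> w _ /=; rewrite lee_fin [leRHS]ger0_norm; last first.
  by rewrite mulr_ge0 ?invr_ge0 ?(ltW dl0)// addr_ge0// expR_ge0.
rewrite -ler_pdivrMl ?invr_gt0// invrK.
have e1 := expR_ge1Dx (dl * W w); have e2 := expR_ge1Dx (- dl * W w).
have e3 := expR_gt0 (dl * W w); have e4 := expR_gt0 (- dl * W w).
by have [W0|W0] := leP 0 (W w); [rewrite ger0_norm|rewrite ltr0_norm]; lra.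
Qed.

(** Comparing first orders in 1 + x m <= E exp (x W) <= exp (C x^2) at x = e and x = -e gives |m| <=
    2 C e for every small e. *)
Lemma mean0_of_Eexp : (\int[P]_w (W w)%:E = 0)%E.
Proof.
have iW := integrable_of_Eexp.
have fW := integrable_fin_num measurableT iW.
rewrite -(fineK fW); congr EFin; set m := fine _.
have lin x : `|x| <= dl -> 1 + x * m <= expR (C * x ^+ 2).
  move=> xdl; rewrite -lee_fin; apply: le_trans (mgf xdl).
  have ixW := integrableZl measurableT x iW.
  have i1 := finite_measure_integrable_cst P 1 measurableT.
  apply: (@le_trans _ _ (\int[P]_w (1 + x%:E * (W w)%:E))%E).
    rewrite (integralD measurableT i1 ixW) (integralZl measurableT iW).
    have := integral_cst P measurableT 1%E; rewrite /= probability_setT mule1 => ->.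
    by rewrite EFinD EFinM fineK.
  apply: le_integral => //; first exact: (integrableD measurableT i1 ixW).
    exact: integrable_expR.
  by move=> w _; rewrite -EFinM -EFinD lee_fin expR_ge1Dx.
have key e : 0 < e -> e <= dl -> C * e ^+ 2 <= 2^-1 -> `|m| <= 2 * C * e.
  move=> e0 edl Ce.
  have h1 : 1 + e * m <= 1 + 2 * (C * e ^+ 2).
    apply: le_trans (lin e _) _; first by rewrite gtr0_norm.
    apply: le_trans (expR_le_1D2sqr Ce) _.
    by have := mulr_ge0 (ltW C0) (sqr_ge0 e); nra.
  have h2 : 1 + - e * m <= 1 + 2 * (C * e ^+ 2).
    apply: le_trans (lin (- e) _) _; first by rewrite normrN gtr0_norm.
    rewrite sqrrN; apply: le_trans (expR_le_1D2sqr Ce) _.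
    by have := mulr_ge0 (ltW C0) (sqr_ge0 e); nra.
  have : `|e * m| <= e * (2 * C * e) by rewrite ler_norml; apply/andP; split; lra.
  by rewrite normrM gtr0_norm// ler_pM2l.
apply/eqP; rewrite -normr_le0; apply/ler_addgt0Pr => eps eps0; rewrite add0r.
pose e := Num.min (Num.min dl 1) (Num.min ((2 * C)^-1) (eps / (2 * C))).
have C20 : 0 < 2 * C by rewrite mulr_gt0.
have e0 : 0 < e by rewrite !lt_min dl0 ltr01 invr_gt0 C20 divr_gt0.
have e1 : e <= 1 by rewrite !ge_min lexx !orbT.
have ed : e <= dl by rewrite !ge_min lexx.
have eC : e <= (2 * C)^-1 by rewrite !ge_min lexx !orbT.
have ee : e <= eps / (2 * C) by rewrite !ge_min lexx !orbT.
apply: le_trans (key e e0 ed _) _; last by rewrite -ler_pdivlMl// mulrC.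
have : C * e <= 2^-1.
  have -> : 2^-1 = C * (2 * C)^-1 by field; rewrite gt_eqF.
  by rewrite ler_pM2l.
have : C * e ^+ 2 <= C * e by rewrite ler_pM2l// expr2 ler_piMr// ltW.
lra.
Qed.

Lemma tail_of_Eexp (s : R) : 0 < s ->
  (P [set w | (s < `|W w|)%R] <=
   (2 * expR (- Num.min (s ^+ 2 / (4 * C)) (dl * s / 2)))%:E)%E.
Proof.
(* The minimizer s / (2C) of C x^2 - x s, truncated at [dl]; in both cases the minimum is at most -
   x s / 2. *)
move=> s0; pose x := Num.min (s / (2 * C)) dl.
have C20 : 0 < 2 * C by rewrite mulr_gt0.
have x0 : 0 < x by rewrite lt_min dl0 divr_gt0.
have xdl : x <= dl by rewrite ge_min lexx orbT.
have xs : x <= s / (2 * C) by rewrite ge_min lexx.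
have ex : C * x ^+ 2 - x * s <= - Num.min (s ^+ 2 / (4 * C)) (dl * s / 2).
  have h : C * x ^+ 2 <= x * s / 2.
    have -> : x * s / 2 = C * x * (s / (2 * C)) by field; rewrite gt_eqF.
    by rewrite expr2 [leLHS]mulrA ler_pM2l// mulr_gt0.
  have : Num.min (s ^+ 2 / (4 * C)) (dl * s / 2) <= x * s / 2.
    rewrite /x; have [h'|h'] := leP (s / (2 * C)) dl.
      rewrite ge_min; apply/orP; left; rewrite le_eqVlt; apply/orP; left; apply/eqP.
      by field; rewrite gt_eqF.
    by rewrite ge_min lexx orbT.
  lra.
have one y : `|y| = x -> (P [set w | (x * s < y * W w)%R] <=
    (expR (- Num.min (s ^+ 2 / (4 * C)) (dl * s / 2)))%:E)%E.
  move=> yx; have y2 : y ^+ 2 = x ^+ 2 by rewrite -yx real_normK// num_real.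
  have h : (Eexp P (fun w => y * W w)%R <= (expR (C * x ^+ 2))%:E)%E.
    by rewrite -y2; apply: mgf; rewrite yx.
  by apply: le_trans (markov_Eexp _ (mxW y) h) _; rewrite lee_fin ler_expR.
have hx : `|x| = x by rewrite gtr0_norm.
have hNx : `|- x| = x by rewrite normrN gtr0_norm.
rewrite mulr_natl mulr2n EFinD; apply: le_trans (leeD (one _ hx) (one _ hNx)).
apply: le_trans (measureU2 _ _ _); last 2 first.
- exact: measurable_ltr_fun.
- exact: measurable_ltr_fun.
apply: le_measure; rewrite ?inE.
- by apply: measurable_ltr_fun; exact: measurableT_comp.
- by apply: measurableU; exact: measurable_ltr_fun.
- move=> w /=; rewrite mulNr -mulrN !ltr_pM2l//.
  by have [W0|W0] := leP 0 (W w); [rewrite ger0_norm//|rewrite ltr0_norm//];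
    [left|right].
Qed.

End tails.

Section preimage_generators.
Context {d} {T : measurableType d} {R : realType}.

(** The generating class inside [sigma_of], named so that the generated sigma-algebra is [sigma_of]
    by unfolding. *)
Definition preim_gen (I : Type) (X : I -> T -> R) : set (set T) :=
  [set A | exists i (B : set R), measurable B /\ A = X i @^-1` B].

Lemma adapted_preim_gen I (X : I -> T -> R) i : adapted (preim_gen X) (X i).
Proof.
by move=> _ B mB; rewrite setTI; apply: sub_sigma_algebra; exists i, B.
Qed.

Lemma preim_gen_measurable I (X : I -> T -> R) :
  (forall i, measurable_fun setT (X i)) -> preim_gen X `<=` measurable.
Proof. by move=> mX _ [i [B [mB ->]]]; rewrite -[X in measurable X]setTI; exact: mX. Qed.

Lemma adapted_comp (G : set (set T)) (f : T -> R) (k : R -> R) :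
  measurable_fun setT k -> adapted G f -> adapted G (k \o f).
Proof. by move=> mk af; exact: (measurableT_comp mk af). Qed.

End preimage_generators.

Section bernoulli_version.
Context {d} {T : measurableType d} {R : realType} (P : probability T R).

(* at1 \o g is {0,1}-valued everywhere, whereas a Bernoulli variable g only is
   almost surely. *)
Definition at1 (x : R) : R := \1_[set 1] x.

Lemma measurable_at1 : measurable_fun setT at1.
Proof. exact: measurable_indic. Qed.

Lemma at1_01 x : at1 x = 0 \/ at1 x = 1.
Proof. by rewrite /at1 indicE; case: (x \in _); [right|left]. Qed.

Lemma at1_ae (g : T -> R) : measurable_fun setT g ->
  P [set w | g w = 0 \/ g w = 1] = 1%E ->
  \forall w \ae P, at1 (g w) = g w.
Proof.
move=> mg Pg; set A := [set w | _] in Pg.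
have mA : measurable A.
  rewrite (_ : A = setT `&` g @^-1` ([set 0] `|` [set 1])); last by rewrite setTI.
  by apply: mg => //; exact: measurableU.
exists (~` A); split; first exact: measurableC.
  by rewrite probability_setC// Pg subee.
move=> w /=; apply: contra_not => -[] ->; rewrite /at1 indicE.
  by rewrite memNset//=; apply/eqP; rewrite eq_sym oner_eq0.
by rewrite mem_set.
Qed.

Lemma bernoulli_at1 (g : T -> R) p : measurable_fun setT g ->
  P [set w | g w = 0 \/ g w = 1] = 1%E -> ('E_P[g] = p%:E)%E ->
  bernoulli_rv P (at1 \o g) p.
Proof.
move=> mg Pg Eg; have mk : measurable_fun setT (at1 \o g).
  exact: measurableT_comp measurable_at1 mg.
split => //; first by move=> w; exact: at1_01.
rewrite -Eg unlock; apply: ae_eq_integral => //; try exact/measurable_EFinP.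
by apply: filterS (at1_ae mg Pg) => w /= -> _.
Qed.

End bernoulli_version.

Theorem theorem1 (R : realType) :
  exists c : R, 0 < c /\
  forall (d : measure_display) (T : measurableType d) (P : probability T R)
    (n : nat) (K1 K2 : R) (Z1 Z2 g1 g2 : 'I_n -> T -> R)
    (pi1 pi2 pi12 : 'I_n -> R) (A : 'M[R]_n),
  (0 < n)%N -> 0 < K1 -> 0 < K2 ->
  (forall j, measurable_fun setT (Z1 j)) ->
  (forall j, measurable_fun setT (Z2 j)) ->
  (forall j, measurable_fun setT (g1 j)) ->
  (forall j, measurable_fun setT (g2 j)) ->
  (* the pairs (Z1j, Z2j) are independent across j *)
  indep_sigma P (fun j : 'I_n =>
    sigma_of (fun b : bool => if b then Z1 j else Z2 j)) ->
  (* the pairs (g1j, g2j) are independent across j *)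
  indep_sigma P (fun j : 'I_n =>
    sigma_of (fun b : bool => if b then g1 j else g2 j)) ->
  (* the family {Z_ij} is independent of the family {g_ij} *)
  indep_sigma P (fun b : bool =>
    if b then sigma_of (fun k : bool * 'I_n => if k.1 then Z1 k.2 else Z2 k.2)
    else sigma_of (fun k : bool * 'I_n => if k.1 then g1 k.2 else g2 k.2)) ->
  (forall j, ('E_P[Z1 j] = 0)%E) -> (forall j, ('E_P[Z2 j] = 0)%E) ->
  (forall j, (psi2norm P (Z1 j) <= K1%:E)%E) ->
  (forall j, (psi2norm P (Z2 j) <= K2%:E)%E) ->
  (* Bernoulli variables *)
  (forall j, P [set w | g1 j w = 0 \/ g1 j w = 1] = 1%E) ->
  (forall j, P [set w | g2 j w = 0 \/ g2 j w = 1] = 1%E) ->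
  (forall j, ('E_P[g1 j] = (pi1 j)%:E)%E) ->
  (forall j, ('E_P[g2 j] = (pi2 j)%:E)%E) ->
  (forall j, ('E_P[fun w => (g1 j w * g2 j w)%R] = (pi12 j)%:E)%E) ->
  let Q := fun w =>
    ((\col_i (Z1 i w * g1 i w))^T *m A *m (\col_j (Z2 j w * g2 j w))) ord0 ord0 in
  forall t : R, 0 < t ->
    (P [set w | (t%:E < `| (Q w)%:E - 'E_P[Q] |)%E ]
     <= (2 * expR (- c * Num.min
          (t ^+ 2 / (K1 ^+ 2 * K2 ^+ 2 * normFpi A pi1 pi2 pi12 ^+ 2))
          (t / (K1 * K2 * opnorm2 A))))%:E)%E.
Proof.
(* The two coefficients left by [tail_of_Eexp] with C = [Chw] N and dl = [hw_radius] / al. *)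
pose c : R := Num.min (4 * Chw)^-1 (hw_radius / 2).
exists c.
have Chw0 := @Chw_gt0 R; have rad0 := @hw_radius_gt0 R.
have c0 : 0 < c by rewrite lt_min invr_gt0 mulr_gt0// divr_gt0.
split=> // d T P n K1 K2 Z1 Z2 g1 g2 pi1 pi2 pi12 A n0 K10 K20 mZ1 mZ2 mg1 mg2.
move=> indZ indG indZG EZ1 EZ2 psi1 psi2 ber1 ber2 Eg1 Eg2 Eg12 Q t t0.
have KK0 : 0 < K1 * K2 by rewrite mulr_gt0.
pose al := opnorm2 A.
have al_ge0 : 0 <= al by exact: sqrtr_ge0.
pose genZ j := preim_gen (fun b : bool => if b then Z1 j else Z2 j).
pose genG j := preim_gen (fun b : bool => if b then g1 j else g2 j).
pose GZ := preim_gen (fun k : bool * 'I_n => if k.1 then Z1 k.2 else Z2 k.2).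
pose GG := preim_gen (fun k : bool * 'I_n => if k.1 then g1 k.2 else g2 k.2).
have genZm i : genZ i `<=` measurable by apply: preim_gen_measurable; case.
have genGm i : genG i `<=` measurable by apply: preim_gen_measurable; case.
have GZm : GZ `<=` measurable.
  by apply: preim_gen_measurable => -[[] j]; [exact: mZ1|exact: mZ2].
have GGm : GG `<=` measurable.
  by apply: preim_gen_measurable => -[[] j]; [exact: mg1|exact: mg2].
have ind2 B C : <<s GZ >> B -> <<s GG >> C -> P (B `&` C) = (P B * P C)%E.
  apply: indep_sigma2 indZG B C => -[].
    exact: (smallest_sub (@sigma_algebra_measurable _ T) GZm).
  exact: (smallest_sub (@sigma_algebra_measurable _ T) GGm).
pose X i w := Z1 i w / K1; pose Y i w := Z2 i w / K2.
pose g i := at1 \o g1 i; pose h i := at1 \o g2 i.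
have mdiv (k : R) : measurable_fun setT (fun x : R => x / k) by exact: measurable_funM.
have aX i : adapted (genZ i) (X i).
  exact: (adapted_comp (mdiv K1) (@adapted_preim_gen _ _ _ _
    (fun b : bool => if b then Z1 i else Z2 i) true)).
have aY i : adapted (genZ i) (Y i).
  exact: (adapted_comp (mdiv K2) (@adapted_preim_gen _ _ _ _
    (fun b : bool => if b then Z1 i else Z2 i) false)).
have ag i : adapted (genG i) (g i).
  exact: (adapted_comp measurable_at1 (@adapted_preim_gen _ _ _ _
    (fun b : bool => if b then g1 i else g2 i) true)).
have ah i : adapted (genG i) (h i).
  exact: (adapted_comp measurable_at1 (@adapted_preim_gen _ _ _ _
    (fun b : bool => if b then g1 i else g2 i) false)).
have aX' i : adapted GZ (X i).
  exact: (adapted_comp (mdiv K1) (@adapted_preim_gen _ _ _ _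
    (fun k : bool * 'I_n => if k.1 then Z1 k.2 else Z2 k.2) (true, i))).
have aY' i : adapted GZ (Y i).
  exact: (adapted_comp (mdiv K2) (@adapted_preim_gen _ _ _ _
    (fun k : bool * 'I_n => if k.1 then Z1 k.2 else Z2 k.2) (false, i))).
have ag' i : adapted GG (g i).
  exact: (adapted_comp measurable_at1 (@adapted_preim_gen _ _ _ _
    (fun k : bool * 'I_n => if k.1 then g1 k.2 else g2 k.2) (true, i))).
have ah' i : adapted GG (h i).
  exact: (adapted_comp measurable_at1 (@adapted_preim_gen _ _ _ _
    (fun k : bool * 'I_n => if k.1 then g1 k.2 else g2 k.2) (false, i))).
have sX i : subgaussian P (X i) by exact: subgaussian_psi2.
have sY i : subgaussian P (Y i) by exact: subgaussian_psi2.
have gp i : bernoulli_rv P (g i) (pi1 i) by exact: bernoulli_at1.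
have hq i : bernoulli_rv P (h i) (pi2 i) by exact: bernoulli_at1.
have mg i : measurable_fun setT (g i) by have [] := gp i.
have mh i : measurable_fun setT (h i) by have [] := hq i.
have ghr i : bernoulli_rv P (fun w => g i w * h i w) (pi12 i).
  apply: bernoulli_rvM (gp i) (hq i) _.
  rewrite -Eg12 unlock; apply: ae_eq_integral => //.
  - by apply/measurable_EFinP; exact: measurable_funM.
  - by apply/measurable_EFinP; exact: measurable_funM.
  - by near=> w => _ /=; congr ((_ * _)%:E); near: w; exact: at1_ae.
pose a (i j : 'I_n) := A i j.
pose W0 w := sparse_form X Y g h a w - sparse_mean P X Y pi12 a.
have NE : normFpi A pi1 pi2 pi12 ^+ 2 = sparse_frob2 pi1 pi2 pi12 a.
  rewrite /normFpi sqr_sqrtr//; apply: addr_ge0; apply: sumr_ge0 => i _.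
    by have /andP[? _] := bernoulli_rv_prob (ghr i); rewrite mulr_ge0// sqr_ge0.
  apply: sumr_ge0 => j _; have /andP[? _] := bernoulli_rv_prob (gp i).
  have /andP[? _] := bernoulli_rv_prob (hq j).
  by apply: mulr_ge0 => //; apply: mulr_ge0 => //; exact: sqr_ge0.
set N := normFpi _ _ _ _ ^+ 2 in NE *.
have mQ : measurable_fun setT Q.
  have -> : Q = (fun w => \sum_i \sum_j A i j * (Z1 i w * g1 i w) * (Z2 j w * g2 j w)).
    apply/funext => w; rewrite /Q mxE exchange_big/=; apply: eq_bigr => j _.
    rewrite !mxE mulr_suml; apply: eq_bigr => i _; rewrite !mxE; ring.
  do 2!(apply: measurable_sum_cond => ? _); apply: measurable_funM.
    by apply: measurable_funM => //; exact: measurable_funM.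
  exact: measurable_funM.
(* Stated for any extended real, because the expectation of [Q] is not yet known to be finite. *)
have mev (e : \bar R) : measurable [set w | (t%:E < `|(Q w)%:E - e|)%E].
  case: e => [e||]; last 2 first.
  - by rewrite (_ : [set w | _] = setT)//; apply/seteqP; split => // w _ /=; rewrite ltry.
  - by rewrite (_ : [set w | _] = setT)//; apply/seteqP; split => // w _ /=; rewrite ltry.
  have := @measurable_ltr_fun _ _ _ (fun w => `|Q w - e|) t.
  apply; apply: measurableT_comp => //; exact: measurable_funB.
(* When [N] or [al] is 0, division by zero yields 0, so the right side is 2 and dominates any
   probability. *)
have trivial_bound u v : u = 0 \/ v = 0 -> 0 <= u -> 0 <= v ->
    (P [set w | (t%:E < `|(Q w)%:E - 'E_P[Q]|)%E] <=
     (2 * expR (- c * Num.min u v))%:E)%E.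
  move=> uv u0 v0; have -> : Num.min u v = 0.
    by case: uv => ->; [rewrite min_l|rewrite min_r].
  rewrite mulr0 expR0 mulr1; apply: le_trans (probability_le1 P (mev _)) _.
  by rewrite lee_fin ler1n.
have u0 : 0 <= t ^+ 2 / (K1 ^+ 2 * K2 ^+ 2 * N).
  by rewrite divr_ge0 ?sqr_ge0// mulr_ge0 ?sqr_ge0// mulr_ge0 ?sqr_ge0.
have v0 : 0 <= t / (K1 * K2 * al).
  by rewrite divr_ge0 ?(ltW t0)// mulr_ge0// ltW.
have [N0|N0] := eqVneq N 0.
  by apply: trivial_bound => //; left; rewrite N0 mulr0 invr0 mulr0.
have [al0|al0] := eqVneq al 0.
  by apply: trivial_bound => //; right; rewrite -/al al0 mulr0 invr0 mulr0.
have {}N0 : 0 < N by rewrite lt_def N0 sqr_ge0.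
have {}al0 : 0 < al by rewrite lt_def al0.
have hA : opbound a (al ^+ 2) by move=> x; exact: sum_sqr_mulmx_le.
have mX i : measurable_fun setT (X i) by exact: (adapted_measurable (@genZm i) (@aX i)).
have mY i : measurable_fun setT (Y i) by exact: (adapted_measurable (@genZm i) (@aY i)).
have mS : measurable_fun setT (sparse_form X Y g h a).
  do 2!(apply: measurable_sum_cond => ? _); apply: measurable_funM.
    by apply: measurable_funM => //; exact: measurable_funM.
  exact: measurable_funM.
have mW0 : measurable_fun setT W0 by exact: measurable_funB.
have rad_al0 : 0 < hw_radius / al by rewrite divr_gt0.
have CN0 : 0 < Chw * N by rewrite mulr_gt0.
have mgf (x : R) : `|x| <= hw_radius / al ->
    (Eexp P (fun w => x * W0 w)%R <= (expR (Chw * N * x ^+ 2))%:E)%E.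
  (* The parameter [x] is moved into the matrix: [|x| <= hw_radius / al] says that x A lies in the
     admissible ball. *)
  move=> xr; pose ax i j := x * a i j.
  have hx : opbound ax (hw_radius ^+ 2).
    move=> y; apply: le_trans (opbound_scale _ hA y) _.
    rewrite ler_wpM2r ?sumr_ge0//; first by move=> j _; rewrite sqr_ge0.
    rewrite -exprMn -(real_normK (num_real (x * al))) lerXn2r ?nnegrE ?(ltW rad0)//.
    by rewrite normrM (gtr0_norm al0) -ler_pdivlMr.
  have := Eexp_sparse_form genZm genGm indZ indG GZm GGm ind2 aX aY ag ah
    aX' aY' ag' ah' sX sY gp hq ghr hx.
  have -> : (fun w => sparse_form X Y g h ax w - sparse_mean P X Y pi12 ax) =
      (fun w => x * W0 w).
    apply/funext => w; rewrite /W0 mulrBr /sparse_form /sparse_mean !mulr_sumr.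
    congr (_ - _); last by apply: eq_bigr => j _; rewrite /ax; ring.
    apply: eq_bigr => i _; rewrite mulr_sumr.
    by apply: eq_bigr => j _; rewrite /ax; ring.
  suff -> : sparse_frob2 pi1 pi2 pi12 ax = x ^+ 2 * N by rewrite mulrA mulrAC.
  rewrite NE /sparse_frob2 mulrDr !mulr_sumr; congr (_ + _).
    by apply: eq_bigr => j _; rewrite /ax; ring.
  apply: eq_bigr => i _; rewrite mulr_sumr.
  by apply: eq_bigr => j _; rewrite /ax; ring.
have iW := integrable_of_Eexp mW0 rad_al0 mgf.
have W00 := mean0_of_Eexp mW0 rad_al0 CN0 mgf.
pose mu := K1 * K2 * sparse_mean P X Y pi12 a.
(* Undoes both normalizations: division by [K1], [K2], and replacement of the Bernoulli variables by
   0-1 valued versions, equal only almost surely. *)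
have QW : \forall w \ae P, Q w = K1 * K2 * W0 w + mu.
  have gae : \forall w \ae P, forall i, g i w = g1 i w.
    by apply: filter_forall => i; exact: at1_ae.
  have hae : \forall w \ae P, forall i, h i w = g2 i w.
    by apply: filter_forall => i; exact: at1_ae.
  near=> w.
  have gw : forall i, g i w = g1 i w by near: w.
  have hw : forall i, h i w = g2 i w by near: w.
  rewrite /mu -mulrDr /W0 subrK /Q /sparse_form mxE exchange_big/= mulr_sumr.
  apply: eq_bigr => j _; rewrite !mxE mulr_suml mulr_sumr.
  apply: eq_bigr => i _; rewrite !mxE gw hw /X /Y /a; field.
  by rewrite !gt_eqF.
have EQ : 'E_P[Q]%E = mu%:E.
  rewrite unlock (ae_eq_integral (fun w => (K1 * K2)%:E * (W0 w)%:E + mu%:E)%E)//.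
  - rewrite integralD//; last 2 first.
    + exact: integrableZl.
    + exact: finite_measure_integrable_cst.
    rewrite integralZl// W00 mule0 add0e.
    by have := integral_cst P measurableT mu%:E; rewrite /= probability_setT mule1.
  - exact/measurable_EFinP.
  - apply: emeasurable_funD => //; apply: measurable_funeM; exact/measurable_EFinP.
  - by apply: filterS QW => w -> _; rewrite EFinD EFinM.
rewrite EQ; case: QW => B [mB PB QWB].
pose s := t / (K1 * K2); have s0 : 0 < s by rewrite divr_gt0.
have mabs : measurable [set w | s < `|W0 w|].
  by apply: measurable_ltr_fun; exact: measurableT_comp.
apply: (@le_trans _ _ (P ([set w | (s < `|W0 w|)%R] `|` B))).
  apply: le_measure; rewrite ?inE; [exact: mev|exact: measurableU|].
  move=> w /= tw; have [Bw|nBw] := pselect (B w); [by right|left].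
  have /contrapT Qw := contra_not (QWB w) nBw.
  move: Qw tw => /= ->; rewrite lte_fin addrK normrM (gtr0_norm KK0).
  by rewrite /s ltr_pdivrMr// mulrC.
have hU : (P ([set w | (s < `|W0 w|)%R] `|` B) <=
    P [set w | (s < `|W0 w|)%R] + P B)%E by exact: measureU2.
rewrite PB adde0 in hU; apply: le_trans hU _.
apply: le_trans (tail_of_Eexp mW0 rad_al0 CN0 mgf s0) _.
rewrite lee_fin ler_pM2l// ler_expR mulNr lerN2.
rewrite -/N -/al; set u := t ^+ 2 / _ in u0 *; set v := t / _ in v0 *.
have -> : s ^+ 2 / (4 * (Chw * N)) = (4 * Chw)^-1 * u.
  by rewrite /s /u; field; rewrite !gt_eqF.
have -> : hw_radius / al * s / 2 = hw_radius / 2 * v.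
  by rewrite /s /v; field; rewrite !gt_eqF.
have cu : c <= (4 * Chw)^-1 by rewrite ge_min lexx.
have cv : c <= hw_radius / 2 by rewrite ge_min lexx orbT.
by rewrite le_min; apply/andP; split; apply: ler_pM; rewrite ?(ltW c0)//
  ?ge_min ?lexx ?orbT// le_min u0 v0.
Unshelve. all: by end_near.
Qed.
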